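(* For every $PMV_f$-algebra $A$ there is an isomorphism of $PMV_f$-algebras $A\cong \Gamma(A^\sharp,u)$, and for every semi-low $l_u$-ring $(R,u)$ there is an isomorphism of semi-low $l_u$-rings $(R,u)\cong (\Gamma(R,u))^\sharp$.
   Context: **MV-algebras.** An MV-algebra is $(A,\oplus,\neg,0)$ with $(A,\oplus,0)$ a commutative monoid, $\neg\neg x=x$, $x\oplus\neg 0=\neg 0$, $\neg(\neg x\oplus y)\oplus y=\neg(\neg y\oplus x)\oplus x$. Put $u=\neg 0$, $x\odot y=\neg(\neg x\oplus\neg y)$, $x\ominus y=\neg(\neg x\oplus y)$; the lattice order is $x\le y\iff x\ominus y=0$. An ideal is a nonempty down-closed subset closed under $\oplus$; an ideal $P$ is prime if $a\wedge b\in P$ implies $a\in P$ or $b\in P$; $Spec(A)$ is the set of prime ideals. For an ideal $I$, $A/I$ is the quotient by $x\equiv_I y\iff (x\ominus y)\oplus(y\ominus x)\in I$, with classes $[x]_I$. **$PMV_f$-algebras.** All products are commutative. A $PMV_f$-algebra is an MV-algebra with an associative commutative product $\cdot$ such that for all $a,b,c$: $a0=0$; $a(b\oplus c)\le ab\oplus ac$; $ab\le a\wedge b$; $a(b\ominus c)=ab\ominus ac$. Homomorphisms are MV-homomorphisms preserving the product. A $PMV_f$-chain is a totally ordered $PMV_f$-algebra. For a $PMV_f$-algebra $A$ every ideal $I$ of the underlying MV-algebra is closed under multiplication by elements of $A$, and $A/I$ is a $PMV_f$-algebra, totally ordered if $I$ is prime. **$l_u$-rings.** All rings are commutative and associative (not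 necessarily with a multiplicative identity). An $l$-ring is a ring whose additive group is a lattice-ordered abelian group and in which $x,y\ge0$ implies $xy\ge 0$. An $l_u$-ring $(R,u)$ is an $l$-ring with a distinguished strong unit $u\ge 0$: for each $x\in R$ there is an integer $n\ge0$ with $|x|\le nu$. It is semi-low if $ab\le a\wedge b$ for all $a,b\in[0,u]$. Homomorphisms are ring homomorphisms that preserve the lattice operations and the strong unit. **$\Gamma$.** $\Gamma(R,u)=\{x\in R: 0\le x\le u\}$ with $x\oplus y=(x+y)\wedge u$, $\neg x=u-x$, and product inherited from $R$. **$A^\sharp$ for chains.** For a $PMV_f$-chain $A$, $A^\sharp$ is $\mathbb Z\times A$ with the identification $(m+1,0)=(m,u)$, addition $(m,a)+(n,b)=(m+n,a\oplus b)$ if $a\oplus b\ne u$ and $(m+n+1,a\odot b)$ if $a\oplus b=u$, negatives $-(m,a)=(-m-1,\neg a)$, lexicographic order (on representatives with second entry $\neq u$), strong unit $(0,u)=(1,0)$, and product $(m,a)(n,b)=mn(0,u^2)+m(0,bu)+n(0,au)+(0,ab)$. **$A^\sharp$ in general.** For a $PMV_f$-algebra $A$ and $a\in A$ let $(0,\widehat a)\in\prod_{P\in Spec(A)}(A/P)^\sharp$ be the element whose $P$-component is $(0,[a]_P)$. Then $A^\sharp$ is the sub-$l$-ring of this product generated by $A^\circ=\{(0,\widehat a):a\in A\}$, with strong unit $(0,\widehat u)$. *)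

(* Defs.v *)
From HB Require Import structures.
From mathcomp Require Import all_boot all_order all_algebra.
From mathcomp Require Import generic_quotient boolp classical_sets.
From mathcomp Require Import zify.
From Stdlib Require Import Relation_Operators.

Set Implicit Arguments.
Unset Strict Implicit.
Unset Printing Implicit Defensive.

Import Order.TTheory GRing.Theory Num.Theory.

Local Open Scope ring_scope.

Declare Scope mv_scope.
Delimit Scope mv_scope with MV.
Local Open Scope mv_scope.

Reserved Notation "x ⊕ y" (at level 50, left associativity).
Reserved Notation "x ⊖ y" (at level 50, left associativity).
Reserved Notation "x ⊙ y" (at level 40, left associativity).
Reserved Notation "¬ x" (at level 35, right associativity).
Reserved Notation "x ⋅ y" (at level 40, left associativity).
Reserved Notation "x ≤ y" (at level 70, no associativity).
Reserved Notation "x ∧ y" (at level 48, left associativity).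
Reserved Notation "x ∙ y" (at level 40, left associativity).
Reserved Notation "x ⊓ y" (at level 48, left associativity).
Reserved Notation "x ⊔ y" (at level 52, left associativity).

HB.mixin Record isMV A of Choice A := {
  mvadd : A -> A -> A;
  mvneg : A -> A;
  mvzero : A;
  mvaddA : associative mvadd;
  mvaddC : commutative mvadd;
  mvadd0 : right_id mvzero mvadd;
  mvnegK : involutive mvneg;
  mvaddN0 : forall x, mvadd x (mvneg mvzero) = mvneg mvzero;
  mv_lukasiewicz : forall x y,
    mvadd (mvneg (mvadd (mvneg x) y)) y = mvadd (mvneg (mvadd (mvneg y) x)) x
}.

#[short(type="mvType")]
HB.structure Definition MV := { A of Choice A & isMV A }.

Notation "x ⊕ y" := (mvadd x y) : mv_scope.
Notation "¬ x" := (mvneg x) : mv_scope.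

Definition mvtop {A : mvType} : A := ¬ mvzero.
Definition mvmul {A : mvType} (x y : A) : A := ¬ (¬ x ⊕ ¬ y).
Definition mvsub {A : mvType} (x y : A) : A := ¬ (¬ x ⊕ y).
Notation "x ⊙ y" := (mvmul x y) : mv_scope.
Notation "x ⊖ y" := (mvsub x y) : mv_scope.

Definition mvle {A : mvType} (x y : A) : bool := x ⊖ y == mvzero.
Notation "x ≤ y" := (mvle x y) : mv_scope.

(* the infimum for [mvle], see [mvle_meet] and [mvle_anti] below *)
Definition mvmeet {A : mvType} (x y : A) : A := x ⊖ (x ⊖ y).
Notation "x ∧ y" := (mvmeet x y) : mv_scope.

Section MVTheory.
Variable A : mvType.
Implicit Types x y z a b c : A.
Local Notation "0" := (@mvzero A) : mv_scope.
Local Notation u := (@mvtop A).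

Lemma mv0add x : 0 ⊕ x = x. Proof. by rewrite mvaddC mvadd0. Qed.
Lemma mvaddT x : x ⊕ u = u. Proof. exact: mvaddN0. Qed.
Lemma mvTadd x : u ⊕ x = u. Proof. by rewrite mvaddC mvaddT. Qed.
Lemma mvneg0 : ¬ 0 = u. Proof. by []. Qed.
Lemma mvnegT : ¬ u = 0. Proof. exact: mvnegK. Qed.
Lemma mvnegI x y : ¬ x = ¬ y -> x = y.
Proof. by move=> e; rewrite -(mvnegK x) e mvnegK. Qed.

Lemma mvaddN x : x ⊕ ¬ x = u.
Proof.
have := mv_lukasiewicz x u; rewrite mvaddT mvnegT mv0add.
by rewrite [¬ x ⊕ x]mvaddC => <-.
Qed.

Lemma mvaddNl x : ¬ x ⊕ x = u. Proof. by rewrite mvaddC mvaddN. Qed.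

Lemma mvaddCA x y z : x ⊕ (y ⊕ z) = y ⊕ (x ⊕ z).
Proof. by rewrite !mvaddA (mvaddC x). Qed.
Lemma mvaddAC x y z : x ⊕ y ⊕ z = x ⊕ z ⊕ y.
Proof. by rewrite -!mvaddA (mvaddC y). Qed.

Lemma mvleE x y : (x ≤ y) = (¬ x ⊕ y == u).
Proof.
apply/eqP/eqP; first by rewrite /mvsub => e; apply: mvnegI; rewrite e mvnegT.
by rewrite /mvsub => ->; rewrite mvnegT.
Qed.

Lemma mvle_refl x : x ≤ x.
Proof. by rewrite mvleE mvaddNl eqxx. Qed.

Lemma mvle_add x y : x ≤ x ⊕ y.
Proof. by rewrite mvleE mvaddA mvaddNl mvTadd eqxx. Qed.

Lemma mvle_addl x y : x ≤ y ⊕ x.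
Proof. by rewrite mvaddC mvle_add. Qed.

Lemma mvsubKC x y : x ≤ y -> x ⊕ (y ⊖ x) = y.
Proof.
rewrite mvleE => /eqP e; have := mv_lukasiewicz x y.
by rewrite e mvnegT mv0add /mvsub [x ⊕ _]mvaddC => <-.
Qed.

Lemma mvle_trans y x z : x ≤ y -> y ≤ z -> x ≤ z.
Proof. by move=> /mvsubKC <- /mvsubKC <-; rewrite -mvaddA mvle_add. Qed.

Lemma mvle_anti x y : x ≤ y -> y ≤ x -> x = y.
Proof.
move=> /mvsubKC e; rewrite /mvle => /eqP f; move: e; rewrite f.
by rewrite mvadd0.
Qed.

Lemma mvle0 x : 0 ≤ x. Proof. by rewrite -(mv0add x) mvle_add. Qed.
Lemma mvleT x : x ≤ u. Proof. by rewrite -(mvaddT x) mvle_add. Qed.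
Lemma mvle0E x : (x ≤ 0) = (x == 0).
Proof.
apply/idP/eqP => [l|->]; last exact: mvle_refl.
by apply: mvle_anti => //; apply: mvle0.
Qed.

Lemma mvle_neg x y : (¬ x ≤ ¬ y) = (y ≤ x).
Proof. by rewrite !mvleE mvnegK mvaddC. Qed.

Lemma mvle_add2l z x y : x ≤ y -> z ⊕ x ≤ z ⊕ y.
Proof. by move=> /mvsubKC <-; rewrite mvaddA mvle_add. Qed.
Lemma mvle_add2r z x y : x ≤ y -> x ⊕ z ≤ y ⊕ z.
Proof. by rewrite !(mvaddC _ z); apply: mvle_add2l. Qed.

Lemma mvmulC x y : x ⊙ y = y ⊙ x. Proof. by rewrite /mvmul mvaddC. Qed.
Lemma mvmulA x y z : x ⊙ (y ⊙ z) = x ⊙ y ⊙ z.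
Proof. by rewrite /mvmul !mvnegK mvaddA. Qed.
Lemma mvmulAC x y z : x ⊙ y ⊙ z = x ⊙ z ⊙ y.
Proof. by rewrite -!mvmulA (mvmulC y). Qed.
Lemma mvmulT x : x ⊙ u = x. Proof. by rewrite /mvmul mvnegT mvadd0 mvnegK. Qed.
Lemma mvTmul x : u ⊙ x = x. Proof. by rewrite mvmulC mvmulT. Qed.
Lemma mvmul0 x : x ⊙ 0 = 0. Proof. by rewrite /mvmul mvneg0 mvaddT mvnegT. Qed.
Lemma mv0mul x : 0 ⊙ x = 0. Proof. by rewrite mvmulC mvmul0. Qed.
Lemma mvmulN x : x ⊙ ¬ x = 0. Proof. by rewrite /mvmul mvaddN mvnegT. Qed.
Lemma mvsubE x y : x ⊖ y = x ⊙ ¬ y. Proof. by rewrite /mvmul mvnegK. Qed.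
Lemma mvnegM x y : ¬ (x ⊙ y) = ¬ x ⊕ ¬ y. Proof. by rewrite /mvmul mvnegK. Qed.
Lemma mvnegD x y : ¬ (x ⊕ y) = ¬ x ⊙ ¬ y. Proof. by rewrite /mvmul !mvnegK. Qed.
Lemma mvnegB x y : ¬ (x ⊖ y) = ¬ x ⊕ y. Proof. by rewrite /mvsub mvnegK. Qed.

Lemma mvle_mul2l z x y : x ≤ y -> z ⊙ x ≤ z ⊙ y.
Proof. by move=> l; rewrite /mvmul mvle_neg mvle_add2l // mvle_neg. Qed.

Lemma mvle_mul x y : x ⊙ y ≤ x.
Proof. by rewrite -{2}(mvmulT x) mvle_mul2l // mvleT. Qed.
Lemma mvle_mull x y : y ⊙ x ≤ x. Proof. by rewrite mvmulC mvle_mul. Qed.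

Lemma mvsubA x y z : x ⊖ y ⊖ z = x ⊖ (y ⊕ z).
Proof. by rewrite /mvsub mvnegK mvaddA. Qed.
Lemma mvle_subl x y z : (x ⊖ y ≤ z) = (x ≤ y ⊕ z).
Proof. by rewrite /mvle mvsubA. Qed.
Lemma mvle_sub x y : x ⊖ y ≤ x.
Proof. by rewrite mvle_subl mvle_addl. Qed.
Lemma mvle_subK x y : x ≤ y ⊕ (x ⊖ y).
Proof. by rewrite -mvle_subl mvle_refl. Qed.
Lemma mvsubxx x : x ⊖ x = 0.
Proof. by apply/eqP; apply: mvle_refl. Qed.
Lemma mvsub0 x : x ⊖ 0 = x.
Proof. by rewrite mvsubE mvneg0 mvmulT. Qed.
Lemma mv0sub x : 0 ⊖ x = 0. Proof. by rewrite mvsubE mv0mul. Qed.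
Lemma mvsub_eq0 x y : (x ⊖ y == 0) = (x ≤ y). Proof. by []. Qed.
Lemma mvsubNN x y : ¬ x ⊖ ¬ y = y ⊖ x.
Proof. by rewrite /mvsub mvnegK mvaddC. Qed.
Lemma mvmul_eq0 x y : (x ⊙ y == 0) = (x ≤ ¬ y).
Proof. by rewrite /mvle mvsubE mvnegK. Qed.
Lemma mvadd_eqT x y : (x ⊕ y == u) = (¬ x ≤ y).
Proof. by rewrite mvleE mvnegK. Qed.

Lemma mvmeetE x y : x ∧ y = x ⊙ (¬ x ⊕ y).
Proof. by []. Qed.

Lemma mvmeetC x y : x ∧ y = y ∧ x.
Proof.
have e a b : ¬ (a ∧ b) = ¬ (¬ ¬ b ⊕ ¬ a) ⊕ ¬ a.
  by rewrite mvmeetE mvnegM mvnegK mvaddC (mvaddC (¬ a)).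
by apply: mvnegI; rewrite !e mv_lukasiewicz.
Qed.

Lemma mvmeet_lel x y : x ∧ y ≤ x. Proof. exact: mvle_sub. Qed.
Lemma mvmeet_ler x y : x ∧ y ≤ y. Proof. by rewrite mvmeetC mvmeet_lel. Qed.

Lemma mvmeet_l x y : x ≤ y -> x ∧ y = x.
Proof. by rewrite mvleE mvmeetE => /eqP ->; rewrite mvmulT. Qed.

Lemma mvmeet_idr x y : y ≤ x -> x ∧ y = y.
Proof. by rewrite mvmeetC; apply: mvmeet_l. Qed.

Lemma mvle_meet x y z : (z ≤ x ∧ y) = (z ≤ x) && (z ≤ y).
Proof.
apply/idP/andP => [l|[lx ly]].
  by split; apply: mvle_trans l _; [apply: mvmeet_lel|apply: mvmeet_ler].
rewrite -(mvmeet_l ly) mvmeetC !(mvmeetC _ y) !mvmeetE.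
by apply: mvle_mul2l; apply: mvle_add2l.
Qed.

Lemma mvprelinear x y : (x ⊖ y) ∧ (y ⊖ x) = 0.
Proof.
rewrite mvmeetE mvnegB !mvsubE.
set v := y ⊙ ¬ x; set w := y ⊕ v.
have -> : ¬ x ⊕ y ⊕ v = ¬ x ⊕ w by rewrite mvaddA.
rewrite mvmulAC -mvmeetE mvmeetC mvmeetE mvmulAC.
have -> : w ⊙ ¬ y = v ⊙ (¬ v ⊕ ¬ y).
  by rewrite -mvmeetE mvmeetC mvmeetE mvnegK mvmulC.
have le : v ≤ w ⊙ ¬ x.
  rewrite /v [y ⊙ _]mvmulC [w ⊙ _]mvmulC; apply: mvle_mul2l; exact: mvle_add.
rewrite mvmulAC.
have -> : v ⊙ (¬ w ⊕ x) = 0.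
  apply/eqP; rewrite mvmul_eq0 mvnegD mvnegK; exact: le.
by rewrite mv0mul.
Qed.

Lemma mvsub_addl x y : y ⊙ x = 0 -> (y ⊕ x) ⊖ y = x.
Proof.
move/eqP; rewrite mvmul_eq0 => le.
rewrite mvsubE mvmulC -[X in X ⊕ x](mvnegK y) -mvmeetE mvmeet_idr //.
by rewrite -mvle_neg mvnegK.
Qed.

Lemma mvcarryA0 a b c : a ⊙ b = 0 -> b ⊙ c = 0 -> (a ⊕ b) ⊙ c = a ⊙ (b ⊕ c).
Proof.
move=> ab bc.
have lb : b ≤ ¬ a by rewrite -mvmul_eq0 mvmulC ab.
have e : ¬ a = b ⊕ (¬ a ⊖ b) by rewrite mvsubKC.
rewrite (mvmulC a) -{2}(mvnegK a) -mvsubE e -mvsubA mvsub_addl //.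
by rewrite [RHS]mvsubE mvnegB mvnegK mvmulC.
Qed.

Lemma mvcarryA1 a b c : a ⊕ b = u -> b ⊕ c = u -> (a ⊙ b) ⊕ c = a ⊕ (b ⊙ c).
Proof.
move=> ab bc; apply: mvnegI; rewrite !mvnegD !mvnegM.
by apply: mvcarryA0; rewrite -mvnegD ?ab ?bc mvnegT.
Qed.

Lemma mvcarryA01 a b c : a ⊙ b = 0 -> b ⊕ c = u -> (a ⊕ b) ⊙ c = a ⊕ (b ⊙ c).
Proof.
move=> ab bc.
have lc : ¬ c ≤ b by rewrite -mvadd_eqT mvaddC bc.
have eb : b = b ⊙ c ⊕ ¬ c.
  by rewrite -[LHS](mvsubKC lc) mvsubE mvnegK mvaddC.
have le : a ⊕ b ⊙ c ≤ c.
  apply: mvle_trans (_ : ¬ b ⊕ b ⊙ c ≤ c).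
    by apply: mvle_add2r; rewrite -mvmul_eq0 ab.
  have -> : b ⊙ c = c ⊖ ¬ b by rewrite mvsubE mvnegK mvmulC.
  by rewrite mvsubKC ?mvle_refl // -mvadd_eqT bc.
rewrite {1}eb mvaddA mvaddC mvmulC -{1}(mvnegK c).
rewrite mvmulC -mvsubE mvsub_addl //.
by apply/eqP; rewrite mvmulC mvmul_eq0 mvnegK.
Qed.

Lemma mvsub_le_add x y z : x ⊖ z ≤ (x ⊖ y) ⊕ (y ⊖ z).
Proof.
rewrite mvle_subl mvaddCA mvaddC; apply: mvle_trans (mvle_subK x y) _.
by rewrite mvaddC [_ ⊕ (x ⊖ y)]mvaddC; apply: mvle_add2l; apply: mvle_subK.
Qed.

Lemma mvsub_add2r x y z : x ⊕ z ⊖ (y ⊕ z) ≤ x ⊖ y.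
Proof.
by rewrite mvle_subl mvaddAC; apply: mvle_add2r; apply: mvle_subK.
Qed.

End MVTheory.
HB.mixin Record MV_isPMVf A of MV A := {
  pmul : A -> A -> A;
  pmulA : associative pmul;
  pmulC : commutative pmul;
  pmul0 : right_zero mvzero pmul;
  pmulD_le : forall a b c, pmul a (b ⊕ c) ≤ pmul a b ⊕ pmul a c;
  pmul_le_meet : forall a b, pmul a b ≤ a ∧ b;
  pmulB : forall a b c, pmul a (b ⊖ c) = pmul a b ⊖ pmul a c
}.

#[short(type="pmvfType")]
HB.structure Definition PMVf := { A of MV A & MV_isPMVf A }.

Notation "x ⋅ y" := (pmul x y) : mv_scope.

HB.mixin Record PMVf_isChain A of PMVf A := {
  mvle_total : total (@mvle A)
}.

#[short(type="pmvfChainType")]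
HB.structure Definition PMVfChain := { A of PMVf A & PMVf_isChain A }.

Record is_pmvf_hom (A B : pmvfType) (f : A -> B) : Prop := {
  pmvf_homD : {morph f : x y / x ⊕ y};
  pmvf_homN : {morph f : x / ¬ x};
  pmvf_hom0 : f mvzero = mvzero;
  pmvf_homM : {morph f : x y / x ⋅ y}
}.

Definition is_pmvf_iso (A B : pmvfType) (f : A -> B) : Prop :=
  is_pmvf_hom f /\ bijective f.

Section PMVfTheory.
Variable A : pmvfType.
Implicit Types x y z a b c : A.
Local Notation "0" := (@mvzero A) : mv_scope.

Lemma p0mul a : 0 ⋅ a = 0. Proof. by rewrite pmulC pmul0. Qed.
Lemma pmul_lel a b : a ⋅ b ≤ a.
Proof. exact: mvle_trans (pmul_le_meet a b) (mvmeet_lel _ _). Qed.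
Lemma pmul_ler a b : a ⋅ b ≤ b.
Proof. by rewrite pmulC pmul_lel. Qed.
Lemma pmulBl a b c : (a ⊖ b) ⋅ c = a ⋅ c ⊖ b ⋅ c.
Proof. by rewrite !(pmulC _ c) pmulB. Qed.
Lemma pmul_le2 a b c : b ≤ c -> a ⋅ b ≤ a ⋅ c.
Proof. by rewrite /mvle => /eqP e; rewrite -pmulB e pmul0. Qed.

Lemma pmul_nocarry x a b : a ⊙ b = 0 ->
  (x ⋅ a) ⊙ (x ⋅ b) = 0 /\ x ⋅ (a ⊕ b) = x ⋅ a ⊕ x ⋅ b.
Proof.
move=> ab.
have le : x ⋅ a ≤ x ⋅ (a ⊕ b) by apply: pmul_le2; apply: mvle_add.
have e : x ⋅ b = x ⋅ (a ⊕ b) ⊖ x ⋅ a by rewrite -pmulB mvsub_addl.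
split; last by rewrite e mvsubKC.
by rewrite e mvsubE mvmulC -mvmulA [¬ _ ⊙ _]mvmulC mvmulN mvmul0.
Qed.

End PMVfTheory.

Record mvideal (A : mvType) := MVIdeal {
  mvideal_set :> A -> Prop;
  mvideal_neq0 : (exists x, mvideal_set x);
  mvideal_down : forall x y, x ≤ y -> mvideal_set y -> mvideal_set x;
  mvideal_add : forall x y, mvideal_set x -> mvideal_set y ->
    mvideal_set (x ⊕ y)
}.

(* No properness requirement: the improper ideal is prime. *)
Record Spec (A : mvType) := PrimeMVIdeal {
  Spec_ideal :> mvideal A;
  Spec_prime : forall a b, Spec_ideal (a ∧ b) -> Spec_ideal a \/ Spec_ideal b
}.

Section MVQuotient.
Variables (A : mvType) (I : mvideal A).
Implicit Types x y z : A.

Definition mvcong x y : bool := `[< I ((x ⊖ y) ⊕ (y ⊖ x)) >].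

Lemma mvideal0 : I mvzero.
Proof.
by have [x Ix] := mvideal_neq0 I; apply: mvideal_down Ix; apply: mvle0.
Qed.

Lemma mvcongP x y : mvcong x y <-> I (x ⊖ y) /\ I (y ⊖ x).
Proof.
split=> [/asboolP Ixy|[Ixy Iyx]]; last by apply/asboolP; apply: mvideal_add.
by split; apply: mvideal_down Ixy; [apply: mvle_add|apply: mvle_addl].
Qed.

Lemma mvcong_refl : reflexive mvcong.
Proof. by move=> x; apply/mvcongP; rewrite mvsubxx; split; apply: mvideal0. Qed.

Lemma mvcong_sym : symmetric mvcong.
Proof. by move=> x y; apply/idP/idP => /mvcongP[? ?]; apply/mvcongP. Qed.

Lemma mvcong_trans : transitive mvcong.
Proof.
have tr x y z : I (x ⊖ y) -> I (y ⊖ z) -> I (x ⊖ z).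
  move=> Ixy Iyz; apply: mvideal_down (mvsub_le_add x y z) _.
  exact: mvideal_add.
move=> y x z /mvcongP[xy yx] /mvcongP[yz zy].
by apply/mvcongP; split; [apply: tr yz|apply: tr yx].
Qed.

Canonical mvcong_equiv := EquivRel mvcong mvcong_refl mvcong_sym mvcong_trans.

Definition mvquot := {eq_quot mvcong}%qT.
HB.instance Definition _ := Choice.on mvquot.
HB.instance Definition _ := Quotient.on mvquot.
HB.instance Definition _ := EqQuotient.on mvquot.

Definition mvclass (x : A) : mvquot := (\pi_mvquot x)%qT.

Lemma mvclass_eq x y : mvclass x = mvclass y <-> I (x ⊖ y) /\ I (y ⊖ x).
Proof.
rewrite -mvcongP; split => [e|e]; last by apply/eqP; rewrite -eqmodE in e.
by have := eqxx (mvclass x); rewrite {2}e /mvclass eqmodE.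
Qed.

Lemma mvclass_surj (X : mvquot) : exists x, X = mvclass x.
Proof. by exists (repr X); rewrite /mvclass reprK. Qed.

Definition mvquot_add (X Y : mvquot) := mvclass (repr X ⊕ repr Y).
Definition mvquot_neg (X : mvquot) := mvclass (¬ repr X).

Lemma mvclass_repr x : mvclass (repr (mvclass x)) = mvclass x.
Proof. exact: reprK. Qed.

Lemma mvclass_neg x : mvquot_neg (mvclass x) = mvclass (¬ x).
Proof.
have /mvclass_eq[? ?] := mvclass_repr x.
by apply/mvclass_eq; rewrite !mvsubNN.
Qed.

Lemma mvclass_add x y : mvquot_add (mvclass x) (mvclass y) = mvclass (x ⊕ y).
Proof.
have add_l a b c : mvclass a = mvclass b -> mvclass (a ⊕ c) = mvclass (b ⊕ c).
  move=> /mvclass_eq[ab ba]; apply/mvclass_eq.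
  by split; apply: mvideal_down (mvsub_add2r _ _ _) _.
rewrite /mvquot_add (add_l _ x) ?mvclass_repr //.
by rewrite !(mvaddC x); apply: add_l; rewrite mvclass_repr.
Qed.

Fact mvquot_addA : associative mvquot_add.
Proof.
move=> X Y Z; have [x ->] := mvclass_surj X; have [y ->] := mvclass_surj Y.
by have [z ->] := mvclass_surj Z; rewrite !mvclass_add mvaddA.
Qed.
Fact mvquot_addC : commutative mvquot_add.
Proof. by move=> X Y; rewrite /mvquot_add mvaddC. Qed.
Fact mvquot_add0 : right_id (mvclass mvzero) mvquot_add.
Proof.
by move=> X; have [x ->] := mvclass_surj X; rewrite mvclass_add mvadd0.
Qed.
Fact mvquot_negK : involutive mvquot_neg.
Proof.
by move=> X; have [x ->] := mvclass_surj X; rewrite !mvclass_neg mvnegK.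
Qed.
Fact mvquot_addN0 X :
  mvquot_add X (mvquot_neg (mvclass mvzero)) = mvquot_neg (mvclass mvzero).
Proof.
by have [x ->] := mvclass_surj X; rewrite mvclass_neg mvclass_add mvaddN0.
Qed.
Fact mvquot_luk X Y :
  mvquot_add (mvquot_neg (mvquot_add (mvquot_neg X) Y)) Y =
  mvquot_add (mvquot_neg (mvquot_add (mvquot_neg Y) X)) X.
Proof.
have [x ->] := mvclass_surj X; have [y ->] := mvclass_surj Y.
by rewrite !(mvclass_neg, mvclass_add) mv_lukasiewicz.
Qed.

HB.instance Definition _ := isMV.Build mvquot
  mvquot_addA mvquot_addC mvquot_add0 mvquot_negK mvquot_addN0 mvquot_luk.

Lemma mvclassD x y : mvclass (x ⊕ y) = mvclass x ⊕ mvclass y.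
Proof. by rewrite -mvclass_add. Qed.
Lemma mvclassN x : mvclass (¬ x) = ¬ mvclass x.
Proof. by rewrite -mvclass_neg. Qed.
Lemma mvclassB x y : mvclass (x ⊖ y) = mvclass x ⊖ mvclass y.
Proof. by rewrite /mvsub !(mvclassN, mvclassD). Qed.

Lemma mvclass_eq0 x : mvclass x = mvzero <-> I x.
Proof.
rewrite mvclass_eq mvsub0 mv0sub; split=> [[]//|Ix].
by split=> //; apply: mvideal0.
Qed.

Lemma mvclass_le x y : (mvclass x ≤ mvclass y) <-> I (x ⊖ y).
Proof. by rewrite -mvclass_eq0 mvclassB; split=> /eqP. Qed.

End MVQuotient.

Section PMVfQuotient.
Variables (A : pmvfType) (I : mvideal A).
Implicit Types x y z : A.
Local Notation mvquot := (mvquot I).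
Local Notation mvclass := (@mvclass A I).

Definition mvquot_mul (X Y : mvquot) : mvquot := mvclass (repr X ⋅ repr Y).

Lemma mvclassM x y : mvclass (x ⋅ y) = mvquot_mul (mvclass x) (mvclass y).
Proof.
have mul_l a b c : mvclass a = mvclass b -> mvclass (a ⋅ c) = mvclass (b ⋅ c).
  move=> /mvclass_eq[ab ba]; apply/mvclass_eq; rewrite -!pmulBl.
  by split; apply: mvideal_down (pmul_lel _ _) _.
rewrite /mvquot_mul (mul_l _ (repr (mvclass x))) ?mvclass_repr //.
by rewrite !(pmulC (repr (mvclass x))); apply: mul_l; rewrite mvclass_repr.
Qed.

Lemma mvclass_le_le x y : x ≤ y -> mvclass x ≤ mvclass y.
Proof. by move=> /eqP e; apply/mvclass_le; rewrite e; apply: mvideal0. Qed.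

Fact mvquot_mulA : associative mvquot_mul.
Proof.
move=> X Y Z; have [x ->] := mvclass_surj X; have [y ->] := mvclass_surj Y.
by have [z ->] := mvclass_surj Z; rewrite -!mvclassM pmulA.
Qed.
Fact mvquot_mulC : commutative mvquot_mul.
Proof. by move=> X Y; rewrite /mvquot_mul pmulC. Qed.
Fact mvquot_mul0 : right_zero (mvzero : mvquot) mvquot_mul.
Proof.
by move=> X; have [x ->] := mvclass_surj X; rewrite -mvclassM pmul0.
Qed.
Fact mvquot_mulD X Y Z :
  mvquot_mul X (Y ⊕ Z) ≤ mvquot_mul X Y ⊕ mvquot_mul X Z.
Proof.
have [x ->] := mvclass_surj X; have [y ->] := mvclass_surj Y.
have [z ->] := mvclass_surj Z.
by rewrite -mvclassD -!mvclassM -mvclassD mvclass_le_le ?pmulD_le.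
Qed.
Fact mvquot_mul_le X Y : mvquot_mul X Y ≤ X ∧ Y.
Proof.
have [x ->] := mvclass_surj X; have [y ->] := mvclass_surj Y.
by rewrite /mvmeet -!mvclassB -mvclassM mvclass_le_le ?pmul_le_meet.
Qed.
Fact mvquot_mulB X Y Z :
  mvquot_mul X (Y ⊖ Z) = mvquot_mul X Y ⊖ mvquot_mul X Z.
Proof.
have [x ->] := mvclass_surj X; have [y ->] := mvclass_surj Y.
have [z ->] := mvclass_surj Z.
by rewrite -mvclassB -!mvclassM pmulB mvclassB.
Qed.

HB.instance Definition _ := MV_isPMVf.Build mvquot
  mvquot_mulA mvquot_mulC mvquot_mul0 mvquot_mulD mvquot_mul_le mvquot_mulB.

End PMVfQuotient.

Section SpecQuotient.
Variables (A : pmvfType) (P : Spec A).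

Fact mvquot_total : total (@mvle (mvquot P)).
Proof.
move=> X Y; have [x ->] := mvclass_surj X; have [y ->] := mvclass_surj Y.
have : P ((x ⊖ y) ∧ (y ⊖ x)) by rewrite mvprelinear; apply: mvideal0.
by case/Spec_prime => /mvclass_le ->; rewrite ?orbT.
Qed.

HB.instance Definition _ := PMVf_isChain.Build (mvquot P) mvquot_total.

End SpecQuotient.
(* Hierarchy Builder refuses a new structure joining [Order.Lattice] and
   [GRing.Zmodule], because [Num.RealDomain] already extends both. The lattice
   operations are therefore introduced over [Num.POrderedZmodule]. *)
HB.mixin Record isLGroup R of Num.POrderedZmodule R := {
  lmeet : R -> R -> R;
  ljoin : R -> R -> R;
  lmeetP : forall z x y : R, (z <= lmeet x y) = (z <= x) && (z <= y);
  ljoinP : forall z x y : R, (ljoin x y <= z) = (x <= z) && (y <= z);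
  lgroup_leD : forall z x y : R, x <= y -> z + x <= z + y
}.

#[short(type="lgroupType")]
HB.structure Definition LGroup := { R of Num.POrderedZmodule R & isLGroup R }.

Notation "x ⊓ y" := (lmeet x y) : ring_scope.
Notation "x ⊔ y" := (ljoin x y) : ring_scope.

(* MathComp's ring structures all have a unit element, hence the separate
   multiplication *)
HB.mixin Record LGroup_isLRing R of LGroup R := {
  lmul : R -> R -> R;
  lmulA : associative lmul;
  lmulC : commutative lmul;
  lmulDl : left_distributive lmul +%R;
  lmul_ge0 : forall x y : R, 0 <= x -> 0 <= y -> 0 <= lmul x y
}.

#[short(type="lringType")]
HB.structure Definition LRing := { R of LGroup R & LGroup_isLRing R }.

Notation "x ∙ y" := (lmul x y) : ring_scope.

HB.mixin Record LRing_isLuRing R of LRing R := {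
  lunit : R;
  lunit_ge0 : 0 <= lunit;
  lunit_strong : forall x : R, exists n : nat, x ⊔ - x <= lunit *+ n
}.

#[short(type="luRingType")]
HB.structure Definition LuRing := { R of LRing R & LRing_isLuRing R }.

HB.mixin Record LuRing_isSemiLow R of LuRing R := {
  lmul_semilow : forall a b : R,
    0 <= a <= lunit -> 0 <= b <= lunit -> a ∙ b <= a ⊓ b
}.

#[short(type="semiLowLuRingType")]
HB.structure Definition SemiLowLuRing := { R of LuRing R & LuRing_isSemiLow R }.

Record is_luring_hom (R S : luRingType) (f : R -> S) : Prop := {
  luring_homD : {morph f : x y / x + y};
  luring_homM : {morph f : x y / x ∙ y};
  luring_homI : {morph f : x y / x ⊓ y};
  luring_homU : {morph f : x y / x ⊔ y};
  luring_hom1 : f lunit = lunit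
}.

Definition is_luring_iso (R S : luRingType) (f : R -> S) : Prop :=
  is_luring_hom f /\ bijective f.

Section LGroupTheory.
Variable R : lgroupType.
Implicit Types x y z : R.

Lemma lg_meetl x y : x ⊓ y <= x.
Proof. by have := lmeetP (x ⊓ y) x y; rewrite lexx => /esym/andP[]. Qed.
Lemma lg_meetr x y : x ⊓ y <= y.
Proof. by have := lmeetP (x ⊓ y) x y; rewrite lexx => /esym/andP[]. Qed.
Lemma lg_joinl x y : x <= x ⊔ y.
Proof. by have := ljoinP (x ⊔ y) x y; rewrite lexx => /esym/andP[]. Qed.
Lemma lg_joinr x y : y <= x ⊔ y.
Proof. by have := ljoinP (x ⊔ y) x y; rewrite lexx => /esym/andP[]. Qed.
Lemma lg_meetC x y : x ⊓ y = y ⊓ x.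
Proof. by apply/le_anti; rewrite !lmeetP !lg_meetl !lg_meetr. Qed.
Lemma lg_joinC x y : x ⊔ y = y ⊔ x.
Proof. by apply/le_anti; rewrite !ljoinP !lg_joinl !lg_joinr. Qed.
Lemma lg_meetA x y z : x ⊓ (y ⊓ z) = x ⊓ y ⊓ z.
Proof.
have l t : (t <= x ⊓ (y ⊓ z)) = (t <= x ⊓ y ⊓ z) by rewrite !lmeetP andbA.
by apply/le_anti; rewrite -l lexx l lexx.
Qed.
Lemma lg_meet_l x y : x <= y -> x ⊓ y = x.
Proof. by move=> xy; apply/le_anti; rewrite lg_meetl lmeetP lexx xy. Qed.
Lemma lg_meet_r x y : y <= x -> x ⊓ y = y.
Proof. by move=> xy; rewrite lg_meetC lg_meet_l. Qed.
Lemma lg_join_l x y : y <= x -> x ⊔ y = x.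
Proof. by move=> xy; apply/le_anti; rewrite lg_joinl ljoinP lexx xy. Qed.
Lemma lg_join_r x y : x <= y -> x ⊔ y = y.
Proof. by move=> xy; rewrite lg_joinC lg_join_l. Qed.

Lemma lg_leD2l z x y : (z + x <= z + y) = (x <= y).
Proof.
apply/idP/idP => [/(lgroup_leD (- z))|]; last exact: lgroup_leD.
by rewrite !addKr.
Qed.
Lemma lg_leD2r z x y : (x + z <= y + z) = (x <= y).
Proof. by rewrite -!(addrC z) lg_leD2l. Qed.
Lemma lg_leD x y z t : x <= y -> z <= t -> x + z <= y + t.
Proof.
by move=> xy zt; apply: (@le_trans _ _ (y + z)); rewrite ?lg_leD2r ?lg_leD2l.
Qed.
Lemma lg_addr_ge0 x y : 0 <= x -> 0 <= y -> 0 <= x + y.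
Proof. by move=> x0 y0; rewrite -[0]addr0 lg_leD. Qed.
Lemma lg_leN2 x y : (- x <= - y) = (y <= x).
Proof. by rewrite -[LHS](lg_leD2l (x + y)) addrK addrAC subrr add0r. Qed.
Lemma lg_subr_ge0 x y : (0 <= y - x) = (x <= y).
Proof. by rewrite -[LHS](lg_leD2r x) add0r subrK. Qed.
Lemma lg_leBl x y z : (x - y <= z) = (x <= z + y).
Proof. by rewrite -[LHS](lg_leD2r y) subrK. Qed.
Lemma lg_leBr x y z : (x <= z - y) = (x + y <= z).
Proof. by rewrite -[LHS](lg_leD2r y) subrK. Qed.
Lemma lg_mulrn_ge0 x n : 0 <= x -> 0 <= x *+ n.
Proof.
by move=> x0; elim: n => [|n IH]; rewrite ?mulr0n // mulrS lg_addr_ge0.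
Qed.
Lemma lg_ler_mulrn x y n : x <= y -> x *+ n <= y *+ n.
Proof.
by move=> xy; elim: n => [|n IH]; rewrite ?mulr0n // !mulrS lg_leD.
Qed.
Lemma lg_ler_muln2l x m n : 0 <= x -> (m <= n)%N -> x *+ m <= x *+ n.
Proof.
move=> x0 /subnKC <-; rewrite mulrnDr -{1}[x *+ m]addr0 lg_leD2l.
exact: lg_mulrn_ge0.
Qed.

Lemma lg_meetD x y z : z + (x ⊓ y) = (z + x) ⊓ (z + y).
Proof.
apply/le_anti; rewrite lmeetP !lg_leD2l lg_meetl lg_meetr /=.
by rewrite [z + (x ⊓ y)]addrC -lg_leBl lmeetP !lg_leBl !(addrC _ z) lg_meetl lg_meetr.
Qed.
Lemma lg_meetDr x y z : (x ⊓ y) + z = (x + z) ⊓ (y + z).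
Proof. by rewrite -!(addrC z) lg_meetD. Qed.
Lemma lg_joinD x y z : z + (x ⊔ y) = (z + x) ⊔ (z + y).
Proof.
apply/le_anti; rewrite ljoinP !lg_leD2l lg_joinl lg_joinr /= andbT.
by rewrite [z + (x ⊔ y)]addrC -lg_leBr ljoinP !lg_leBr !(addrC _ z) lg_joinl lg_joinr.
Qed.
Lemma lg_joinDr x y z : (x ⊔ y) + z = (x + z) ⊔ (y + z).
Proof. by rewrite -!(addrC z) lg_joinD. Qed.
Lemma lg_oppI x y : - (x ⊓ y) = - x ⊔ - y.
Proof.
apply/le_anti; rewrite ljoinP !lg_leN2 lg_meetl lg_meetr andbT.
by rewrite -[_ ⊔ _]opprK lg_leN2 lmeetP -lg_leN2 opprK lg_joinl -lg_leN2 opprK lg_joinr.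
Qed.
Lemma lg_oppU x y : - (x ⊔ y) = - x ⊓ - y.
Proof. by apply: oppr_inj; rewrite lg_oppI !opprK. Qed.

Lemma lg_pos_sub x y : x - (x ⊓ y) = (x - y) ⊔ 0.
Proof. by rewrite lg_oppI lg_joinD subrr lg_joinC. Qed.

Lemma lg_split x : x = (x ⊔ 0) - (- x ⊔ 0).
Proof.
by have := lg_pos_sub x 0; rewrite subr0 lg_oppU opprK oppr0 => <-; rewrite subrK.
Qed.

End LGroupTheory.

Section LRingTheory.
Variable R : lringType.
Implicit Types x y z : R.

Lemma lmulDr z x y : z ∙ (x + y) = z ∙ x + z ∙ y.
Proof. by rewrite !(lmulC z) lmulDl. Qed.
Lemma lmul0 x : x ∙ 0 = 0.
Proof. by apply: (addIr (x ∙ 0)); rewrite -lmulDr !add0r. Qed.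
Lemma l0mul x : 0 ∙ x = 0. Proof. by rewrite lmulC lmul0. Qed.
Lemma lmulN x y : x ∙ (- y) = - (x ∙ y).
Proof. by apply: (addIr (x ∙ y)); rewrite -lmulDr !addNr lmul0. Qed.
Lemma lmulNl x y : (- x) ∙ y = - (x ∙ y).
Proof. by rewrite !(lmulC _ y) lmulN. Qed.
Lemma lmulBr z x y : z ∙ (x - y) = z ∙ x - z ∙ y.
Proof. by rewrite lmulDr lmulN. Qed.
Lemma lmulMn x y n : x ∙ (y *+ n) = (x ∙ y) *+ n.
Proof.
by elim: n => [|n IH]; rewrite ?mulr0n ?lmul0 // !mulrS lmulDr IH.
Qed.
Lemma lmulMnl x y n : (x *+ n) ∙ y = (x ∙ y) *+ n.
Proof. by rewrite !(lmulC _ y) lmulMn. Qed.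
Lemma lmul_le2l z x y : 0 <= z -> x <= y -> z ∙ x <= z ∙ y.
Proof.
by move=> z0; rewrite -lg_subr_ge0 => xy; rewrite -lg_subr_ge0 -lmulBr lmul_ge0.
Qed.
Lemma lmul_le2r z x y : 0 <= z -> x <= y -> x ∙ z <= y ∙ z.
Proof. by rewrite !(lmulC _ z); apply: lmul_le2l. Qed.

End LRingTheory.

Section Gamma.
Variable R : semiLowLuRingType.
Implicit Types x y z : R.
Local Notation u := (@lunit R).

Definition Gamma : predArgType := {x : R | (0 <= x) && (x <= u)}.
HB.instance Definition _ := [isSub of Gamma for sval].
HB.instance Definition _ := [Choice of Gamma by <:].
Definition GammaElt x (x01 : (0 <= x) && (x <= u)) : Gamma := exist _ x x01.
Implicit Types a b c : Gamma.

Fact Gamma_add_subproof a b :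
  (0 <= (val a + val b) ⊓ u) && ((val a + val b) ⊓ u <= u).
Proof.
have /andP[a0 _] := valP a; have /andP[b0 _] := valP b.
by rewrite lmeetP lg_addr_ge0 // lunit_ge0 lg_meetr.
Qed.
Fact Gamma_neg_subproof a : (0 <= u - val a) && (u - val a <= u).
Proof.
have /andP[a0 a1] := valP a.
by rewrite lg_subr_ge0 a1 lg_leBl -[leLHS]addr0 lg_leD2l.
Qed.
Fact Gamma_zero_subproof : (0 <= (0 : R)) && ((0 : R) <= u).
Proof. by rewrite lexx lunit_ge0. Qed.
Fact Gamma_mul_subproof a b : (0 <= val a ∙ val b) && (val a ∙ val b <= u).
Proof.
have a01 := valP a; have b01 := valP b.
have := lmul_semilow _ _ a01 b01; rewrite lmeetP => /andP[le _].
have /andP[a0 a1] := a01; have /andP[b0 _] := b01.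
by rewrite lmul_ge0 // (le_trans le).
Qed.

Definition Gamma_add a b : Gamma := GammaElt (Gamma_add_subproof a b).
Definition Gamma_neg a : Gamma := GammaElt (Gamma_neg_subproof a).
Definition Gamma_zero : Gamma := GammaElt Gamma_zero_subproof.
Definition Gamma_mul a b : Gamma := GammaElt (Gamma_mul_subproof a b).

Fact Gamma_addC : commutative Gamma_add.
Proof. by move=> a b; apply: val_inj; rewrite /= addrC. Qed.

Fact Gamma_addA : associative Gamma_add.
Proof.
have e a b c : val (Gamma_add (Gamma_add a b) c) =
    (val a + val b + val c) ⊓ u.
  rewrite /= lg_meetDr -lg_meetA; congr (_ ⊓ _).
  have /andP[c0 _] := valP c.
  by apply: lg_meet_r; rewrite -[leLHS]addr0 lg_leD2l.
move=> a b c; apply: val_inj.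
by rewrite [RHS]e Gamma_addC e addrC addrA.
Qed.

Fact Gamma_add0 : right_id Gamma_zero Gamma_add.
Proof.
move=> a; apply: val_inj; rewrite /= addr0 lg_meet_l //.
by have /andP[] := valP a.
Qed.
Fact Gamma_negK : involutive Gamma_neg.
Proof. by move=> a; apply: val_inj; rewrite /= opprB addrC subrK. Qed.
Fact Gamma_addN0 a : Gamma_add a (Gamma_neg Gamma_zero) = Gamma_neg Gamma_zero.
Proof.
apply: val_inj; rewrite /= subr0 lg_meet_r //.
by have /andP[a0 _] := valP a; rewrite -[leLHS]add0r lg_leD2r.
Qed.

Let addE a b : val (Gamma_add a b) = (val a + val b) ⊓ u. Proof. by []. Qed.

Let subE a b : val (Gamma_neg (Gamma_add (Gamma_neg a) b)) =
  (val a - val b) ⊔ 0.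
Proof.
rewrite /= lg_oppI lg_joinD subrr; congr (_ ⊔ _).
by rewrite opprD opprB addrA addrCA subrr addr0.
Qed.

Fact Gamma_luk a b :
  Gamma_add (Gamma_neg (Gamma_add (Gamma_neg a) b)) b =
  Gamma_add (Gamma_neg (Gamma_add (Gamma_neg b) a)) a.
Proof.
apply: val_inj; rewrite [LHS]addE [RHS]addE.
by rewrite !subE !lg_joinDr !subrK !add0r lg_joinC.
Qed.

HB.instance Definition _ := isMV.Build Gamma
  Gamma_addA Gamma_addC Gamma_add0 Gamma_negK Gamma_addN0 Gamma_luk.

Lemma val_mvsub a b : val (a ⊖ b) = (val a - val b) ⊔ 0.
Proof. exact: subE. Qed.

Lemma Gamma_le a b : (a ≤ b) = (val a <= val b).
Proof.
rewrite /mvle -val_eqE val_mvsub /=; apply/eqP/idP => [e|le].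
  have := lg_joinl (val a - val b) 0.
  by rewrite e lg_leBl add0r.
by rewrite lg_join_r // lg_leBl add0r.
Qed.

Lemma val_mvmeet a b : val (a ∧ b) = val a ⊓ val b.
Proof.
apply/le_anti; rewrite lmeetP -!Gamma_le mvmeet_lel mvmeet_ler andTb.
have h : (0 <= val a ⊓ val b) && (val a ⊓ val b <= u).
  have /andP[a0 a1] := valP a; have /andP[b0 _] := valP b.
  by rewrite lmeetP a0 b0 (le_trans (lg_meetl _ _)).
have -> : val a ⊓ val b = val (GammaElt h) by [].
by rewrite -Gamma_le mvle_meet !Gamma_le /= lg_meetl lg_meetr.
Qed.

Fact Gamma_mulA : associative Gamma_mul.
Proof. by move=> a b c; apply: val_inj; rewrite /= lmulA. Qed.
Fact Gamma_mulC : commutative Gamma_mul.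
Proof. by move=> a b; apply: val_inj; rewrite /= lmulC. Qed.
Fact Gamma_mul0 : right_zero (mvzero : Gamma) Gamma_mul.
Proof. by move=> a; apply: val_inj; rewrite /= lmul0. Qed.
Fact Gamma_mulD a b c : Gamma_mul a (b ⊕ c) ≤ Gamma_mul a b ⊕ Gamma_mul a c.
Proof.
have /andP[a0 _] := valP a.
rewrite Gamma_le /= lmeetP -lmulDr lmul_le2l ?lg_meetl //=.
by have /andP[_] := valP (Gamma_mul a (b ⊕ c)).
Qed.
Fact Gamma_mul_le a b : Gamma_mul a b ≤ a ∧ b.
Proof.
by rewrite Gamma_le val_mvmeet; exact: lmul_semilow _ _ (valP a) (valP b).
Qed.
Fact Gamma_mulB a b c : Gamma_mul a (b ⊖ c) = Gamma_mul a b ⊖ Gamma_mul a c.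
Proof.
have /andP[a0 _] := valP a.
have le d : val (Gamma_mul a d) <= val d.
  have := lmul_semilow _ _ (valP a) (valP d).
  by rewrite lmeetP => /andP[].
have pq : val (b ⊖ c) - val (c ⊖ b) = val b - val c.
  by rewrite !val_mvsub -[val c - val b]opprB -lg_split.
have pq0 : val (b ⊖ c) ⊓ val (c ⊖ b) = 0 by rewrite -val_mvmeet mvprelinear.
have apq0 : val (Gamma_mul a (b ⊖ c)) ⊓ val (Gamma_mul a (c ⊖ b)) = 0.
  apply/le_anti/andP; split.
    rewrite -[leRHS]pq0 lmeetP (le_trans (lg_meetl _ _) (le _)).
    by rewrite (le_trans (lg_meetr _ _) (le _)).
  have ge0 d : 0 <= val (Gamma_mul a d) by case/andP: (valP (Gamma_mul a d)).
  by rewrite lmeetP !ge0.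
have e : val (Gamma_mul a b) - val (Gamma_mul a c) =
    val (Gamma_mul a (b ⊖ c)) - val (Gamma_mul a (c ⊖ b)).
  by rewrite -[LHS]lmulBr -[RHS]lmulBr pq.
by apply: val_inj; rewrite [RHS]val_mvsub e -lg_pos_sub apq0 subr0.
Qed.

HB.instance Definition _ := MV_isPMVf.Build Gamma
  Gamma_mulA Gamma_mulC Gamma_mul0 Gamma_mulD Gamma_mul_le Gamma_mulB.

End Gamma.
Section ChainSharp.
Variable C : pmvfChainType.
Implicit Types (a b c : C) (m n k : int) (p q r : int * C).
Local Notation u := (@mvtop C).
Local Notation o := (@mvzero C).

Lemma mvchain_carry a b : a ⊙ b = o \/ a ⊕ b = u.
Proof.
case/orP: (mvle_total a (¬ b)) => le; [left|right].
  by apply/eqP; rewrite mvmul_eq0.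
by apply/eqP; rewrite mvaddC mvadd_eqT.
Qed.

(* The identification (m+1,0) = (m,u) is the generated equivalence; it
   collapses everything when the chain is trivial (u = 0). *)
Definition csharp_step p q : Prop := exists m, p = (m + 1, o) /\ q = (m, u).
Definition csharp_rel p q : bool :=
  `[< clos_refl_sym_trans (int * C) csharp_step p q >].

Fact csharp_rel_refl : reflexive csharp_rel.
Proof. by move=> p; apply/asboolP; apply: rst_refl. Qed.
Fact csharp_rel_sym : symmetric csharp_rel.
Proof.
by move=> p q; apply/idP/idP => /asboolP h; apply/asboolP; apply: rst_sym.
Qed.
Fact csharp_rel_trans : transitive csharp_rel.
Proof.
move=> q p r /asboolP pq /asboolP qr; apply/asboolP; exact: rst_trans qr.
Qed.

Canonical csharp_equiv :=
  EquivRel csharp_rel csharp_rel_refl csharp_rel_sym csharp_rel_trans.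

Definition csharp := {eq_quot csharp_rel}%qT.
HB.instance Definition _ := Choice.on csharp.
HB.instance Definition _ := Quotient.on csharp.
HB.instance Definition _ := EqQuotient.on csharp.
Implicit Types X Y Z : csharp.

Definition cclass p : csharp := (\pi_csharp p)%qT.
Local Notation "[ m , a ]" := (cclass (m, a)) (format "[ m ,  a ]").

Lemma cclass_carry m : [m + 1, o] = [m, u].
Proof.
apply/eqP; rewrite /cclass eqmodE; apply/asboolP; apply: rst_step.
by exists m.
Qed.

Lemma cclass_repr X : cclass (repr X) = X. Proof. exact: reprK. Qed.

Lemma csharp_lift (T : Type) (f : int * C -> T) p q :
  (forall m, f (m + 1, o) = f (m, u)) -> cclass p = cclass q -> f p = f q.
Proof.
move=> fP pq; have := eqxx (cclass p); rewrite {2}pq /cclass eqmodE.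
move=> /asboolP; elim=> // {pq} [_ _ [m [-> ->]]//|x y z _ -> _ ->//].
Qed.

Lemma csharp_lift_repr (T : Type) (f : int * C -> T) p :
  (forall m, f (m + 1, o) = f (m, u)) -> f (repr (cclass p)) = f p.
Proof. by move=> fP; apply: csharp_lift => //; rewrite cclass_repr. Qed.

Lemma csharpP X : exists m a, X = [m, a].
Proof. by exists (repr X).1, (repr X).2; rewrite -surjective_pairing cclass_repr. Qed.

Lemma csharp_trivial : u = o -> forall X Y, X = Y.
Proof.
move=> e; have a0 a : a = o by apply/eqP; rewrite -mvle0E -e mvleT.
have st m : [m + 1, o] = [m, o] by rewrite cclass_carry e.
have s0 m : [m, o] = [0, o].
  elim/int_rect: m => // n IH; first by rewrite -addn1 PoszD st.
  by rewrite -IH -st -addn1 PoszD; congr [_, _]; lia.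
by move=> X Y; have [m [a ->]] := csharpP X; have [n [b ->]] := csharpP Y;
  rewrite (a0 a) (a0 b) !s0.
Qed.

Definition cadd p q : int * C :=
  if p.2 ⊕ q.2 == u then (p.1 + q.1 + 1, p.2 ⊙ q.2)
  else (p.1 + q.1, p.2 ⊕ q.2).
Definition copp p : int * C := (- p.1 - 1, ¬ p.2).
Definition csharp_add X Y := cclass (cadd (repr X) (repr Y)).
Definition csharp_opp X := cclass (copp (repr X)).

Lemma cclass_opp m a : csharp_opp [m, a] = [- m - 1, ¬ a].
Proof.
rewrite /csharp_opp (csharp_lift_repr (f := fun p => cclass (copp p))) //.
move=> k; rewrite /copp /= mvnegT mvneg0 -cclass_carry.
by congr [_, _]; lia.
Qed.

Lemma csharp_addC : commutative csharp_add.
Proof.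
by move=> X Y; rewrite /csharp_add /cadd mvaddC mvmulC (addrC (repr X).1).
Qed.

Lemma cclass_add p q : csharp_add (cclass p) (cclass q) = cclass (cadd p q).
Proof.
have addl x y : cclass (cadd (repr (cclass x)) y) = cclass (cadd x y).
  apply: (csharp_lift_repr (f := fun x => cclass (cadd x y))) => m.
  case: y => n b; rewrite /cadd /= mv0add mvTadd eqxx mv0mul mvTmul.
  case: eqP => [->|_]; first by rewrite -[RHS]cclass_carry; congr [_, _]; lia.
  by congr [_, _]; lia.
rewrite /csharp_add addl.
have cC x y : cadd x y = cadd y x.
  by rewrite /cadd mvaddC mvmulC (addrC x.1).
by rewrite cC addl cC.
Qed.

Lemma cclass_addT m n a b : a ⊕ b = u ->
  csharp_add [m, a] [n, b] = [m + n + 1, a ⊙ b].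
Proof. by move=> e; rewrite cclass_add /cadd /= e eqxx. Qed.

Lemma cclass_add0 m n a b : a ⊙ b = o ->
  csharp_add [m, a] [n, b] = [m + n, a ⊕ b].
Proof.
move=> e; rewrite cclass_add /cadd /= e; case: eqP => // ->.
by rewrite cclass_carry.
Qed.

Fact csharp_addA : associative csharp_add.
Proof.
move=> X Y Z; have [m [a ->]] := csharpP X; have [n [b ->]] := csharpP Y.
have [k [c ->]] := csharpP Z.
have e01 (x y z : C) i j l : x ⊙ y = o -> y ⊕ z = u ->
    csharp_add [i, x] (csharp_add [j, y] [l, z]) =
    csharp_add (csharp_add [i, x] [j, y]) [l, z].
  move=> xy yz; rewrite (cclass_addT _ _ yz) (cclass_add0 _ _ xy).
  rewrite [RHS]cclass_addT; last by rewrite -mvaddA yz mvaddT.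
  rewrite [LHS]cclass_add0; last by rewrite mvmulA xy mv0mul.
  by rewrite mvcarryA01 //; congr [_, _]; lia.
have [ab|ab] := mvchain_carry a b; have [bc|bc] := mvchain_carry b c.
- rewrite (cclass_add0 _ _ ab) (cclass_add0 _ _ bc).
  have [h|h] := mvchain_carry (a ⊕ b) c.
    by rewrite !cclass_add0 -?mvcarryA0 // mvaddA addrA.
  rewrite (cclass_addT _ _ h) cclass_addT ?mvaddA //.
  by rewrite mvcarryA0 // addrA.
- exact: e01.
- rewrite [LHS]csharp_addC [RHS]csharp_addC.
  rewrite (csharp_addC [n, b]) (csharp_addC [m, a]) -e01 //.
    by rewrite mvmulC.
  by rewrite mvaddC.
- rewrite (cclass_addT _ _ ab) (cclass_addT _ _ bc).
  have [h|h] := mvchain_carry (a ⊙ b) c.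
    rewrite (cclass_add0 _ _ h) cclass_add0 ?mvmulA // mvcarryA1 //.
    by congr [_, _]; lia.
  rewrite (cclass_addT _ _ h) cclass_addT -?mvcarryA1 // mvmulA.
  by congr [_, _]; lia.
Qed.

Fact csharp_add0 : left_id [0, o] csharp_add.
Proof.
move=> X; have [m [a ->]] := csharpP X.
by rewrite cclass_add0 ?mv0mul // mv0add add0r.
Qed.

Fact csharp_addN : left_inverse [0, o] csharp_opp csharp_add.
Proof.
move=> X; have [m [a ->]] := csharpP X.
rewrite cclass_opp cclass_addT ?mvaddNl // mvmulC mvmulN.
by congr [_, _]; lia.
Qed.

HB.instance Definition _ := GRing.isZmodule.Build csharp
  csharp_addA csharp_addC csharp_add0 csharp_addN.

Definition cinj a : csharp := [0, a].
Local Notation ι := cinj.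

Lemma cinj0 : ι o = 0. Proof. by []. Qed.

Lemma cclassD0 m n a b : a ⊙ b = o -> [m, a] + [n, b] = [m + n, a ⊕ b].
Proof. exact: cclass_add0. Qed.

Lemma cclassDT m n a b : a ⊕ b = u -> [m, a] + [n, b] = [m + n + 1, a ⊙ b].
Proof. exact: cclass_addT. Qed.

Lemma cinjD a b : a ⊙ b = o -> ι (a ⊕ b) = ι a + ι b.
Proof. by move=> e; rewrite /cinj cclassD0. Qed.

Lemma cinjDT a b : a ⊕ b = u -> ι u + ι (a ⊙ b) = ι a + ι b.
Proof.
move=> e; rewrite /cinj [RHS]cclassDT // -cclass_carry cclassD0 ?mv0mul //.
by rewrite mv0add; congr [_, _]; lia.
Qed.

Lemma cclassE m a : [m, a] = ι u *~ m + ι a.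
Proof.
have -> : ι u *~ m = [m, o].
  elim/int_rect: m => [|n IH|n IH]; first by rewrite mulr0z.
    rewrite intS addrC mulrzDr mulr1z IH /cinj -cclass_carry cclassD0 ?mv0mul //.
    by rewrite mv0add.
  rewrite intS opprD mulrzDr IH mulrNz mulr1z.
  apply: (addrI (ι u)); rewrite addrA subrr add0r /cinj -cclass_carry.
  by rewrite cclassD0 ?mv0mul // mv0add; congr [_, _]; lia.
by rewrite cclassD0 ?mv0mul // mv0add addr0.
Qed.

Lemma cclassN m a : - [m, a] = [- m - 1, ¬ a].
Proof. exact: cclass_opp. Qed.

(* The first disjunct only matters for the trivial chain, where no element has
   a representative with second entry different from u; otherwise the second
   one is already reflexive. *)
Definition csharp_le X Y : bool :=
  `[< X = Y \/ exists m a n b, [/\ X = [m, a] /\ a <> u, Y = [n, b] /\ b <> u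
        & m < n \/ m = n /\ a ≤ b] >].

Definition cnf p := if p.2 == u then (p.1 + 1, o) else p.

Lemma cnfP X : u <> o -> exists m a, X = [m, a] /\ a <> u.
Proof.
move=> nt; have [m [a ->]] := csharpP X; have [->|/eqP] := eqVneq a u.
  by exists (m + 1), o; rewrite cclass_carry; split=> // /esym.
by move=> au; exists m, a.
Qed.

Lemma cnf_inj m a n b : u <> o -> a <> u -> b <> u -> [m, a] = [n, b] ->
  m = n /\ a = b.
Proof.
move=> nt /eqP au /eqP bu /(csharp_lift (f := cnf)) h.
suff: cnf (m, a) = cnf (n, b).
  by rewrite /cnf /= (negPf au) (negPf bu) => -[-> ->].
by apply: h => k; rewrite /cnf /= eqxx; case: eqP => // /esym.
Qed.

Lemma csharp_leE m a n b : u <> o -> a <> u -> b <> u ->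
  csharp_le [m, a] [n, b] = (m < n) || (m == n) && (a ≤ b).
Proof.
move=> nt au bu; apply/asboolP/orP.
  case=> [/cnf_inj[]// -> ->|]; first by right; rewrite eqxx mvle_refl.
  move=> [m' [a' [n' [b' [[/cnf_inj h au'] [/cnf_inj h' bu']]]]]].
  have [//|//|//|-> ->] := h; have [//|//|//|-> ->] := h'.
  by case=> [|[-> ->]]; [left|right; rewrite eqxx].
move=> h; right; exists m, a, n, b; split=> //.
by case: h => [|/andP[/eqP]]; [left|right].
Qed.

Lemma csharp_le_sub X Y : csharp_le X Y = csharp_le 0 (Y - X).
Proof.
have [e|nt] := pselect (u = o).
  by rewrite (csharp_trivial e X 0) (csharp_trivial e Y 0) subr0.
have [m [a [-> au]]] := cnfP X nt; have [n [b [-> bu]]] := cnfP Y nt.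
have ou : o <> u by move/esym.
rewrite csharp_leE // cclassN -[X in csharp_le X _]/[0, o].
have [ab|nab] := boolP (a ≤ b).
  have e : b ⊕ ¬ a = u by apply/eqP; rewrite mvaddC -mvleE.
  rewrite cclassDT // csharp_leE //; last first.
    move=> h; apply: bu; apply: mvle_anti; first exact: mvleT.
    by rewrite -h mvle_mul.
  by rewrite mvle0; lia.
have e : b ⊙ ¬ a = o.
  have [//|] := mvchain_carry b (¬ a); move/eqP.
  by rewrite mvaddC -mvleE (negPf nab).
rewrite cclassD0 // csharp_leE //; last first.
  by move/eqP; rewrite mvaddC -mvleE (negPf nab).
by rewrite mvle0; lia.
Qed.

Fact csharp_le_refl : reflexive csharp_le.
Proof. by move=> X; apply/asboolP; left. Qed.

Fact csharp_le_anti : antisymmetric csharp_le.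
Proof.
move=> X Y; have [e _|nt] := pselect (u = o); first exact: csharp_trivial.
have [m [a [-> au]]] := cnfP X nt; have [n [b [-> bu]]] := cnfP Y nt.
rewrite !csharp_leE // => h.
have mn : m = n by lia.
move: h; rewrite mn !ltxx eqxx /= => /andP[ab ba].
by rewrite (mvle_anti ab ba).
Qed.

Fact csharp_le_trans : transitive csharp_le.
Proof.
move=> Y X Z; have [e|nt] := pselect (u = o).
  by rewrite (csharp_trivial e X Z) => _ _; apply: csharp_le_refl.
have [m [a [-> au]]] := cnfP X nt; have [n [b [-> bu]]] := cnfP Y nt.
have [k [c [-> cu]]] := cnfP Z nt; rewrite !csharp_leE //.
case/orP => [mn|/andP[/eqP -> ab]].
  case/orP => [nk|/andP[/eqP <- _]]; last by rewrite mn.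
  by rewrite (lt_trans mn nk).
case/orP => [->//|/andP[/eqP -> bc]].
by rewrite eqxx (mvle_trans ab bc) orbT.
Qed.

Fact csharp_le_total X Y : csharp_le X Y || csharp_le Y X.
Proof.
have [e|nt] := pselect (u = o).
  by rewrite (csharp_trivial e X Y) csharp_le_refl.
have [m [a [-> au]]] := cnfP X nt; have [n [b [-> bu]]] := cnfP Y nt.
rewrite !csharp_leE //; case: (ltgtP m n) => //= _.
exact: mvle_total.
Qed.

HB.instance Definition _ := Order.Le_isPOrder.Build ring_display csharp
  csharp_le_refl csharp_le_anti csharp_le_trans.

Lemma csharpleE X Y : (X <= Y) = csharp_le X Y. Proof. by []. Qed.

Definition csharp_meet X Y := if X <= Y then X else Y.
Definition csharp_join X Y := if X <= Y then Y else X.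

Fact csharp_meetP Z X Y : (Z <= csharp_meet X Y) = (Z <= X) && (Z <= Y).
Proof.
rewrite /csharp_meet; case: ifP => [XY|nXY].
  by apply/idP/andP => [ZX|[]//]; rewrite ZX (le_trans ZX).
have YX : Y <= X by have := csharp_le_total X Y; rewrite -!csharpleE nXY.
by apply/idP/andP => [ZY|[]//]; rewrite ZY (le_trans ZY).
Qed.

Fact csharp_joinP Z X Y : (csharp_join X Y <= Z) = (X <= Z) && (Y <= Z).
Proof.
rewrite /csharp_join; case: ifP => [XY|nXY].
  by apply/idP/andP => [YZ|[]//]; rewrite YZ (le_trans XY).
have YX : Y <= X by have := csharp_le_total X Y; rewrite -!csharpleE nXY.
by apply/idP/andP => [XZ|[]//]; rewrite XZ (le_trans YX).
Qed.

Fact csharp_leD Z X Y : X <= Y -> Z + X <= Z + Y.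
Proof.
rewrite !csharpleE (csharp_le_sub X) (csharp_le_sub (Z + X)).
by rewrite opprD addrACA subrr add0r.
Qed.

HB.instance Definition _ := isLGroup.Build csharp
  csharp_meetP csharp_joinP csharp_leD.

Lemma cinj_le a b : a ≤ b -> ι a <= ι b.
Proof.
move=> ab; have -> : b = a ⊕ (b ⊖ a) by rewrite mvsubKC.
rewrite cinjD; last by rewrite mvsubE mvmulC -mvmulA [_ ⊙ a]mvmulC mvmulN mvmul0.
rewrite -[leLHS]addr0 lg_leD2l csharpleE.
have [e|nt] := pselect (u = o).
  by rewrite (csharp_trivial e 0 (ι (b ⊖ a))) csharp_le_refl.
have [->|/eqP nu] := eqVneq (b ⊖ a) u.
  rewrite /cinj -cclass_carry -[X in csharp_le X _]/[0, o].
  by rewrite csharp_leE // => /esym.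
by rewrite -[X in csharp_le X _]/[0, o] csharp_leE ?mvle0 // => /esym.
Qed.

Lemma cinj_ge0 a : 0 <= ι a. Proof. by apply: cinj_le; apply: mvle0. Qed.

Lemma csharp_ge0P X : 0 <= X -> exists (n : nat) a, X = ι u *+ n + ι a.
Proof.
have [e _|nt] := pselect (u = o).
  by exists 0%N, o; apply: csharp_trivial.
have [m [a [-> au]]] := cnfP X nt; rewrite csharpleE csharp_leE //; last first.
  by move/esym.
move=> h; have [n ->] : exists n : nat, m = n by case: m h => // n _; exists n.
by exists n, a; rewrite cclassE.
Qed.

Lemma csharp_bounded X : exists n : nat, X ⊔ - X <= ι u *+ n.
Proof.
have half Y : exists n : nat, Y <= ι u *+ n.
  have [m [a ->]] := csharpP Y; exists (`|m|.+1)%N.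
  rewrite cclassE mulrSr; apply: lg_leD; last by apply: cinj_le; apply: mvleT.
  case: m => n //; rewrite NegzE mulrNz.
  apply: (@le_trans _ _ 0); last exact/lg_mulrn_ge0/cinj_ge0.
  rewrite -[leRHS]oppr0 lg_leN2; exact/lg_mulrn_ge0/cinj_ge0.
have [[n Xn] [k Xk]] := (half X, half (- X)); exists (n + k)%N.
rewrite ljoinP (le_trans Xn) ?(le_trans Xk) //.
  by apply: lg_ler_muln2l; rewrite ?leq_addl ?cinj_ge0.
by apply: lg_ler_muln2l; rewrite ?leq_addr ?cinj_ge0.
Qed.

Lemma csharp_intervalP X : 0 <= X <= ι u -> exists a, X = ι a.
Proof.
move=> /andP[]; have [e _ _|nt] := pselect (u = o).
  by exists o; apply: csharp_trivial.
have [m [a [-> au]]] := cnfP X nt.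
have ou : o <> u by move/esym.
rewrite !csharpleE -[X in csharp_le X _]/[0, o] /cinj -[[0, u]]cclass_carry.
rewrite !csharp_leE // mvle0E add0r => h1 h2.
have [m0|m1] : m = 0 \/ m = 1 by lia.
  by exists a; rewrite m0.
have -> : a = o by apply/eqP; move: h2; rewrite m1.
by exists u; rewrite m1 -[[0, u]]cclass_carry.
Qed.

Definition cmul p q : csharp :=
  ι (u ⋅ u) *~ (p.1 * q.1) + ι (q.2 ⋅ u) *~ p.1 + ι (p.2 ⋅ u) *~ q.1
  + ι (p.2 ⋅ q.2).
Definition csharp_mul X Y := cmul (repr X) (repr Y).

Let ctr c q : csharp := ι (c ⋅ u) *~ q.1 + ι (c ⋅ q.2).

Let ctrE c m : ctr c (m + 1, o) = ctr c (m, u).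
Proof. by rewrite /ctr /= pmul0 mulrzDr mulr1z addr0. Qed.

Let cmulE p q : cmul p q = ctr u q *~ p.1 + ctr p.2 q.
Proof.
rewrite /cmul /ctr mulrzDl -mulrzA [q.1 * _]mulrC !addrA.
by rewrite (pmulC q.2 u).
Qed.

Lemma cmul_sym p q : cmul p q = cmul q p.
Proof.
by rewrite /cmul mulrC (pmulC p.2 q.2) -!addrA; congr (_ + _); rewrite addrCA.
Qed.

Lemma csharp_mulC : commutative csharp_mul.
Proof. by move=> X Y; apply: cmul_sym. Qed.

Lemma cclass_mul p q : csharp_mul (cclass p) (cclass q) = cmul p q.
Proof.
have mulr x y : cmul x (repr (cclass y)) = cmul x y.
  by apply: (csharp_lift_repr (f := cmul x)) => m; rewrite !cmulE !ctrE.
by rewrite /csharp_mul mulr cmul_sym mulr cmul_sym.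
Qed.

Lemma cinjM a b : csharp_mul (ι a) (ι b) = ι (a ⋅ b).
Proof. by rewrite cclass_mul /cmul /= mul0r !mulr0z !add0r. Qed.

Let ctrD c m n a b : exists q,
  [m, a] + [n, b] = cclass q /\ ctr c q = ctr c (m, a) + ctr c (n, b).
Proof.
have [ab|ab] := mvchain_carry a b.
  exists (m + n, a ⊕ b); split; first exact: cclassD0.
  have [e1 e2] := pmul_nocarry c ab.
  by rewrite /ctr /= mulrzDr e2 cinjD // addrACA.
exists (m + n + 1, a ⊙ b); split; first exact: cclassDT.
rewrite /ctr /= !mulrzDr mulr1z -!addrA; congr (_ + _).
rewrite [RHS]addrCA; congr (_ + _).
have le : ¬ a ≤ b by rewrite -mvadd_eqT ab.
have bE : b = ¬ a ⊕ (a ⊙ b).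
  by rewrite mvmulC -{2}(mvnegK a) -mvsubE mvsubKC.
have [e2 e1] := pmul_nocarry c (mvmulN a).
have dis : ¬ a ⊙ (a ⊙ b) = o by rewrite mvmulA [¬ a ⊙ a]mvmulC mvmulN mv0mul.
have [e3 e4] := pmul_nocarry c dis.
rewrite {2}bE e4 cinjD // -[u](mvaddN a) e1 cinjD //.
by rewrite addrA.
Qed.

Fact csharp_mulDr X Y Z :
  csharp_mul X (Y + Z) = csharp_mul X Y + csharp_mul X Z.
Proof.
have [m [a ->]] := csharpP X; have [n [b ->]] := csharpP Y.
have [k [c ->]] := csharpP Z.
have cD d : ctr d (repr ([n, b] + [k, c])) = ctr d (n, b) + ctr d (k, c).
  have [q [-> <-]] := ctrD d n k b c.
  by apply: (csharp_lift_repr (f := ctr d)) => i; apply: ctrE.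
rewrite -[[n, b] + [k, c]]cclass_repr !cclass_mul !cmulE /= !cD.
by rewrite mulrzDl addrACA.
Qed.

Fact csharp_mulDl : left_distributive csharp_mul +%R.
Proof. by move=> X Y Z; rewrite !(csharp_mulC _ Z) csharp_mulDr. Qed.

Lemma csharp_ind (P : csharp -> Prop) : (forall a, P (ι a)) ->
  (forall X Y, P X -> P Y -> P (X + Y)) -> (forall X, P X -> P (- X)) ->
  forall X, P X.
Proof.
move=> Pi PD PN X; have [m [a ->]] := csharpP X; rewrite cclassE.
have Pn (n : nat) : P (ι u *+ n).
  by elim: n => [|n IH]; rewrite ?mulr0n ?mulrS; [apply: (Pi o)|apply: PD].
by apply: PD => //; case: m => n; rewrite ?NegzE ?mulrNz; [|apply: PN]; apply: Pn.
Qed.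

Let mul0 X : csharp_mul X 0 = 0.
Proof. by apply: (addIr (csharp_mul X 0)); rewrite -csharp_mulDr !add0r. Qed.
Let mulN X Y : csharp_mul X (- Y) = - csharp_mul X Y.
Proof.
by apply: (addIr (csharp_mul X Y)); rewrite -csharp_mulDr !addNr mul0.
Qed.
Let mulNl X Y : csharp_mul (- X) Y = - csharp_mul X Y.
Proof. by rewrite !(csharp_mulC _ Y) mulN. Qed.

Fact csharp_mulA : associative csharp_mul.
Proof.
move=> X Y Z; elim/csharp_ind: X => [a|X X' e e'|X e]; last 2 first.
- rewrite [LHS]csharp_mulDl e e' (csharp_mulDl X X' Y).
  by rewrite [RHS]csharp_mulDl.
- by rewrite [LHS]mulNl e (mulNl X Y) [RHS]mulNl.
elim/csharp_ind: Y => [b|Y Y' e e'|Y e]; last 2 first.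
- rewrite (csharp_mulDl Y Y' Z) [LHS]csharp_mulDr e e'.
  by rewrite (csharp_mulDr (ι a) Y Y') [RHS]csharp_mulDl.
- by rewrite (mulNl Y Z) [LHS]mulN e (mulN (ι a) Y) [RHS]mulNl.
elim/csharp_ind: Z => [c|Z Z' e e'|Z e]; last 2 first.
- rewrite (csharp_mulDr (ι b) Z Z') [LHS]csharp_mulDr e e'.
  by rewrite [RHS]csharp_mulDr.
- by rewrite (mulN (ι b) Z) [LHS]mulN e [RHS]mulN.
by rewrite !cinjM pmulA.
Qed.

Fact csharp_mul_ge0 X Y : 0 <= X -> 0 <= Y -> 0 <= csharp_mul X Y.
Proof.
move=> /csharp_ge0P[n [a ->]] /csharp_ge0P[k [b ->]].
have mulnr Z T i : 0 <= csharp_mul Z T -> 0 <= csharp_mul Z (T *+ i).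
  move=> h; elim: i => [|i IH]; first by rewrite mulr0n mul0.
  by rewrite mulrS csharp_mulDr lg_addr_ge0.
have mulnl Z T i : 0 <= csharp_mul Z T -> 0 <= csharp_mul (Z *+ i) T.
  by rewrite !(csharp_mulC _ T); apply: mulnr.
have ii c d : 0 <= csharp_mul (ι c) (ι d) by rewrite cinjM cinj_ge0.
rewrite [X in 0 <= X]csharp_mulDl; apply: lg_addr_ge0.
  rewrite [X in 0 <= X]csharp_mulDr; apply: lg_addr_ge0; last exact/mulnl/ii.
  exact/mulnl/mulnr/ii.
rewrite [X in 0 <= X]csharp_mulDr; apply: lg_addr_ge0; last exact: ii.
exact/mulnr/ii.
Qed.

HB.instance Definition _ := LGroup_isLRing.Build csharp
  csharp_mulA csharp_mulC csharp_mulDl csharp_mul_ge0.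

HB.instance Definition _ := LRing_isLuRing.Build csharp
  (cinj_ge0 u) csharp_bounded.

Fact csharp_semilow X Y : 0 <= X <= ι u -> 0 <= Y <= ι u -> X ∙ Y <= X ⊓ Y.
Proof.
move=> /csharp_intervalP[a ->] /csharp_intervalP[b ->].
have -> : ι a ∙ ι b = ι (a ⋅ b) by exact: cinjM.
by rewrite lmeetP !cinj_le ?pmul_lel ?pmul_ler.
Qed.

HB.instance Definition _ := LuRing_isSemiLow.Build csharp csharp_semilow.

End ChainSharp.

Section LProd.
Variables (I : Type) (F : I -> lringType).

Definition lprod := forall i, F i.
HB.instance Definition _ := Choice.copy lprod (forall i, F i).
Implicit Types x y z : lprod.

Let lprod_ext x y : (forall i, x i = y i) -> x = y.
Proof. exact: functional_extensionality_dep. Qed.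

Definition lprod_add x y : lprod := fun i => x i + y i.
Definition lprod_opp x : lprod := fun i => - x i.
Definition lprod_zero : lprod := fun i => 0.

Fact lprod_addA : associative lprod_add.
Proof. by move=> x y z; apply: lprod_ext => i; apply: addrA. Qed.
Fact lprod_addC : commutative lprod_add.
Proof. by move=> x y; apply: lprod_ext => i; apply: addrC. Qed.
Fact lprod_add0 : left_id lprod_zero lprod_add.
Proof. by move=> x; apply: lprod_ext => i; apply: add0r. Qed.
Fact lprod_addN : left_inverse lprod_zero lprod_opp lprod_add.
Proof. by move=> x; apply: lprod_ext => i; apply: addNr. Qed.

HB.instance Definition _ := GRing.isZmodule.Build lprod
  lprod_addA lprod_addC lprod_add0 lprod_addN.

Definition lprod_le x y : bool := `[< forall i, x i <= y i >].

Fact lprod_le_refl : reflexive lprod_le.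
Proof. by move=> x; apply/asboolP. Qed.
Fact lprod_le_anti : antisymmetric lprod_le.
Proof.
move=> x y /andP[/asboolP xy /asboolP yx]; apply: lprod_ext => i.
by apply/le_anti; rewrite xy yx.
Qed.
Fact lprod_le_trans : transitive lprod_le.
Proof.
move=> y x z /asboolP xy /asboolP yz; apply/asboolP => i.
exact: le_trans (xy i) (yz i).
Qed.

HB.instance Definition _ := Order.Le_isPOrder.Build ring_display lprod
  lprod_le_refl lprod_le_anti lprod_le_trans.

Lemma lprod_leP x y : reflect (forall i, x i <= y i) (x <= y).
Proof. exact: asboolP. Qed.

Definition lprod_meet x y : lprod := fun i => x i ⊓ y i.
Definition lprod_join x y : lprod := fun i => x i ⊔ y i.
Definition lprod_mul x y : lprod := fun i => x i ∙ y i.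

Fact lprod_meetP z x y : (z <= lprod_meet x y) = (z <= x) && (z <= y).
Proof.
apply/lprod_leP/andP => [h|[/lprod_leP hx /lprod_leP hy] i].
  by split; apply/lprod_leP => i; have := h i; rewrite lmeetP => /andP[].
by rewrite lmeetP hx hy.
Qed.
Fact lprod_joinP z x y : (lprod_join x y <= z) = (x <= z) && (y <= z).
Proof.
apply/lprod_leP/andP => [h|[/lprod_leP hx /lprod_leP hy] i].
  by split; apply/lprod_leP => i; have := h i; rewrite ljoinP => /andP[].
by rewrite ljoinP hx hy.
Qed.
Fact lprod_leD z x y : x <= y -> z + x <= z + y.
Proof.
by move=> /lprod_leP xy; apply/lprod_leP => i; exact/lgroup_leD/xy.
Qed.

HB.instance Definition _ := isLGroup.Build lprod
  lprod_meetP lprod_joinP lprod_leD.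

Fact lprod_mulA : associative lprod_mul.
Proof. by move=> x y z; apply: lprod_ext => i; apply: lmulA. Qed.
Fact lprod_mulC : commutative lprod_mul.
Proof. by move=> x y; apply: lprod_ext => i; apply: lmulC. Qed.
Fact lprod_mulDl : left_distributive lprod_mul +%R.
Proof. by move=> x y z; apply: lprod_ext => i; apply: lmulDl. Qed.
Fact lprod_mul_ge0 x y : 0 <= x -> 0 <= y -> 0 <= lprod_mul x y.
Proof.
move=> /lprod_leP x0 /lprod_leP y0; apply/lprod_leP => i.
exact: lmul_ge0 (x0 i) (y0 i).
Qed.

HB.instance Definition _ := LGroup_isLRing.Build lprod
  lprod_mulA lprod_mulC lprod_mulDl lprod_mul_ge0.

End LProd.

Record is_sublring (R : lringType) (S : set R) : Prop := {
  sublring0 : S 0;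
  sublringB : forall x y, S x -> S y -> S (x - y);
  sublringM : forall x y, S x -> S y -> S (x ∙ y);
  sublringI : forall x y, S x -> S y -> S (x ⊓ y);
  sublringU : forall x y, S x -> S y -> S (x ⊔ y)
}.

Section GeneratedSubLRing.
Variables (R : lringType) (X : set R).

Definition lgen_set : set R := smallest (@is_sublring R) X.

Lemma is_sublring_lgen : is_sublring lgen_set.
Proof.
split.
- by move=> S [[]].
- move=> x y Sx Sy S SX; have [[_ B _ _ _] _] := SX.
  by apply: B; [apply: Sx|apply: Sy].
- move=> x y Sx Sy S SX; have [[_ _ B _ _] _] := SX.
  by apply: B; [apply: Sx|apply: Sy].
- move=> x y Sx Sy S SX; have [[_ _ _ B _] _] := SX.
  by apply: B; [apply: Sx|apply: Sy].
- move=> x y Sx Sy S SX; have [[_ _ _ _ B] _] := SX.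
  by apply: B; [apply: Sx|apply: Sy].
Qed.

Definition lgen : predArgType := {x : R | `[< lgen_set x >]}.
HB.instance Definition _ := [isSub of lgen for sval].
HB.instance Definition _ := [Choice of lgen by <:].
Implicit Types x y z : lgen.

Definition lgen_elt (x : R) (Xx : lgen_set x) : lgen :=
  exist _ x (asboolT Xx).

Lemma lgenP x : lgen_set (val x). Proof. exact: asboolW (valP x). Qed.

Fact lgen_opp_subproof x : lgen_set (- val x).
Proof.
rewrite -sub0r; apply: sublringB is_sublring_lgen _ _ _ (lgenP x).
exact: sublring0 is_sublring_lgen.
Qed.
Fact lgen_add_subproof x y : lgen_set (val x + val y).
Proof.
rewrite -[val y]opprK; apply: sublringB is_sublring_lgen _ _ (lgenP x) _.
exact: lgen_opp_subproof.
Qed.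

Definition lgen_zero := lgen_elt (sublring0 is_sublring_lgen).
Definition lgen_opp x := lgen_elt (lgen_opp_subproof x).
Definition lgen_add x y := lgen_elt (lgen_add_subproof x y).
Definition lgen_mul x y :=
  lgen_elt (sublringM is_sublring_lgen (lgenP x) (lgenP y)).
Definition lgen_meet x y :=
  lgen_elt (sublringI is_sublring_lgen (lgenP x) (lgenP y)).
Definition lgen_join x y :=
  lgen_elt (sublringU is_sublring_lgen (lgenP x) (lgenP y)).
Definition lgen_le x y : bool := val x <= val y.

Fact lgen_addA : associative lgen_add.
Proof. by move=> x y z; apply: val_inj; apply: addrA. Qed.
Fact lgen_addC : commutative lgen_add.
Proof. by move=> x y; apply: val_inj; apply: addrC. Qed.
Fact lgen_add0 : left_id lgen_zero lgen_add.
Proof. by move=> x; apply: val_inj; apply: add0r. Qed.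
Fact lgen_addN : left_inverse lgen_zero lgen_opp lgen_add.
Proof. by move=> x; apply: val_inj; apply: addNr. Qed.

HB.instance Definition _ := GRing.isZmodule.Build lgen
  lgen_addA lgen_addC lgen_add0 lgen_addN.

Fact lgen_le_refl : reflexive lgen_le.
Proof. by move=> x; apply: lexx. Qed.
Fact lgen_le_anti : antisymmetric lgen_le.
Proof. by move=> x y h; apply: val_inj; apply: le_anti. Qed.
Fact lgen_le_trans : transitive lgen_le.
Proof. by move=> y x z; apply: le_trans. Qed.

HB.instance Definition _ := Order.Le_isPOrder.Build ring_display lgen
  lgen_le_refl lgen_le_anti lgen_le_trans.

Lemma lgen_leE x y : (x <= y) = (val x <= val y). Proof. by []. Qed.

Fact lgen_meetP z x y : (z <= lgen_meet x y) = (z <= x) && (z <= y).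
Proof. by rewrite !lgen_leE -lmeetP. Qed.
Fact lgen_joinP z x y : (lgen_join x y <= z) = (x <= z) && (y <= z).
Proof. by rewrite !lgen_leE -ljoinP. Qed.
Fact lgen_leD z x y : x <= y -> z + x <= z + y.
Proof. by rewrite !lgen_leE; apply: lgroup_leD. Qed.

HB.instance Definition _ := isLGroup.Build lgen
  lgen_meetP lgen_joinP lgen_leD.

Fact lgen_mulA : associative lgen_mul.
Proof. by move=> x y z; apply: val_inj; apply: lmulA. Qed.
Fact lgen_mulC : commutative lgen_mul.
Proof. by move=> x y; apply: val_inj; apply: lmulC. Qed.
Fact lgen_mulDl : left_distributive lgen_mul +%R.
Proof. by move=> x y z; apply: val_inj; apply: lmulDl. Qed.
Fact lgen_mul_ge0 x y : 0 <= x -> 0 <= y -> 0 <= lgen_mul x y.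
Proof. by rewrite !lgen_leE; apply: lmul_ge0. Qed.

HB.instance Definition _ := LGroup_isLRing.Build lgen
  lgen_mulA lgen_mulC lgen_mulDl lgen_mul_ge0.

Lemma lgen_valMn x n : val (x *+ n) = val x *+ n.
Proof. by elim: n => [|n IH]; rewrite ?mulr0n // !mulrS -IH. Qed.

End GeneratedSubLRing.

Section Bounded.
Variables (R : lringType) (e : R).
Hypotheses (e0 : 0 <= e) (ee : e ∙ e <= e).
Implicit Types x y z p q : R.

Definition lbounded : set R := fun x => exists n : nat, x ⊔ - x <= e *+ n.

Let bnd2 x y : lbounded x -> lbounded y -> exists n : nat,
  [/\ x <= e *+ n, - x <= e *+ n, y <= e *+ n & - y <= e *+ n].
Proof.
move=> [n]; rewrite ljoinP => /andP[n1 n2] [k].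
rewrite ljoinP => /andP[k1 k2]; exists (n + k)%N.
have nl : e *+ n <= e *+ (n + k) by apply: lg_ler_muln2l; rewrite ?leq_addr.
have kl : e *+ k <= e *+ (n + k) by apply: lg_ler_muln2l; rewrite ?leq_addl.
by split; [exact: le_trans nl|exact: le_trans nl
  |exact: le_trans kl|exact: le_trans kl].
Qed.

Lemma is_sublring_bounded : is_sublring lbounded.
Proof.
have neN n : - (e *+ n) <= e *+ n.
  apply: (@le_trans _ _ 0); last exact: lg_mulrn_ge0.
  by rewrite -[leRHS]oppr0 lg_leN2; exact: lg_mulrn_ge0.
split=> [|x y bx by_|x y bx by_|x y bx by_|x y bx by_].
- by exists 0%N; rewrite mulr0n ljoinP oppr0 lexx.
- have [n [x1 x2 y1 y2]] := bnd2 bx by_; exists (n + n)%N.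
  by rewrite ljoinP mulrnDr opprB addrC !lg_leD // addrC lg_leD.
- have [n [x1 x2 y1 y2]] := bnd2 bx by_.
  have ne0 : 0 <= e *+ n by exact: lg_mulrn_ge0.
  have part p : p <= e *+ n -> 0 <= p ⊔ 0 <= e *+ n.
    by move=> pn; rewrite lg_joinr ljoinP pn ne0.
  have prod p q : 0 <= p <= e *+ n -> 0 <= q <= e *+ n ->
      0 <= p ∙ q <= e *+ (n * n).
    move=> /andP[p0 pn] /andP[q0 qn]; rewrite lmul_ge0 //=.
    apply: le_trans (lmul_le2l p0 qn) _; apply: le_trans (lmul_le2r ne0 pn) _.
    by rewrite lmulMn lmulMnl -mulrnA lg_ler_mulrn.
  have /prod/(_ (part _ y1)) := part _ x1; have /prod/(_ (part _ y2)) := part _ x1.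
  have /prod/(_ (part _ y1)) := part _ x2; have /prod/(_ (part _ y2)) := part _ x2.
  set xp := x ⊔ 0; set xn := - x ⊔ 0; set yp := y ⊔ 0; set yn := - y ⊔ 0.
  move=> /andP[a0 a1] /andP[b0 b1] /andP[c0 c1] /andP[d0 d1].
  have -> : x ∙ y = (xp ∙ yp + xn ∙ yn) - (xp ∙ yn + xn ∙ yp).
    rewrite {1}(lg_split x) {1}(lg_split y) -/xp -/xn -/yp -/yn.
    rewrite lmulBr lmulDl lmulNl lmulDl lmulNl !opprD opprK.
    rewrite -!addrA; congr (_ + _).
    by rewrite addrC -!addrA [RHS]addrCA; congr (_ + _); rewrite addrC.
  exists (n * n + n * n)%N; rewrite ljoinP opprB mulrnDr.
  have sub p q m : 0 <= q -> p <= m -> p - q <= m.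
    by move=> q0 pm; rewrite lg_leBl -[leLHS]addr0 lg_leD.
  by rewrite !sub ?lg_addr_ge0 ?lg_leD.
- have [n [x1 x2 y1 y2]] := bnd2 bx by_; exists n.
  by rewrite lg_oppI !ljoinP (le_trans (lg_meetl _ _) x1) x2 y2.
- have [n [x1 x2 y1 y2]] := bnd2 bx by_; exists n.
  by rewrite lg_oppU !ljoinP x1 y1 (le_trans (lg_meetl _ _) x2).
Qed.

End Bounded.

Section Sharp.
Variable A : pmvfType.

Definition sharp_prod := lprod (fun P : Spec A => csharp (mvquot P)).
HB.instance Definition _ := LRing.on sharp_prod.

Definition hat (a : A) : sharp_prod := fun P => cinj (mvclass P a).

Definition sharp := lgen (range hat).
HB.instance Definition _ := LRing.on sharp.

Lemma lgen_hat a : lgen_set (range hat) (hat a).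
Proof. by apply: sub_gen_smallest; exists a. Qed.

Definition sharp_hat (a : A) : sharp := lgen_elt (lgen_hat a).

Fact sharp_unit_ge0 : 0 <= sharp_hat mvtop.
Proof. by rewrite lgen_leE; apply/lprod_leP => P; apply: cinj_ge0. Qed.

Fact sharp_bounded (x : sharp) :
  exists n : nat, x ⊔ - x <= sharp_hat mvtop *+ n.
Proof.
have e0 : 0 <= hat mvtop by exact: sharp_unit_ge0.
have hT a : hat a <= hat mvtop.
  apply/lprod_leP => P; apply: cinj_le.
  exact: mvclass_le_le (mvleT a).
have ee : hat mvtop ∙ hat mvtop <= hat mvtop.
  apply/lprod_leP => P; apply: (@le_trans _ _ (cinj (mvclass P mvtop ⋅ mvclass P mvtop))).
    by rewrite -cinjM lexx.
  exact/cinj_le/pmul_lel.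
have sub : (range hat `<=` lbounded (hat mvtop))%classic.
  move=> _ [a _ <-]; exists 1%N; rewrite mulr1n ljoinP hT /=.
  apply: (le_trans _ e0); rewrite -[leRHS]oppr0 lg_leN2.
  by apply/lprod_leP => P; apply: cinj_ge0.
have [n xn] := smallest_sub (is_sublring_bounded e0 ee) sub (lgenP x).
by exists n; rewrite lgen_leE lgen_valMn.
Qed.

HB.instance Definition _ := LRing_isLuRing.Build sharp
  sharp_unit_ge0 sharp_bounded.

Fact sharp_semilow (x y : sharp) :
  0 <= x <= lunit -> 0 <= y <= lunit -> x ∙ y <= x ⊓ y.
Proof.
move=> /andP[]; rewrite !lgen_leE => /lprod_leP x0 /lprod_leP x1.
move=> /andP[/lprod_leP y0 /lprod_leP y1].
apply/lprod_leP => P; have := mvclassN P mvzero.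
move: (x0 P) (x1 P) (y0 P) (y1 P); rewrite -/mvtop => x0P x1P y0P y1P e.
by apply: csharp_semilow; apply/andP; rewrite -[mvtop]e.
Qed.

HB.instance Definition _ := LuRing_isSemiLow.Build sharp sharp_semilow.

End Sharp.

(* Main.v *)
Require Import Defs.
From mathcomp Require Import all_boot all_order all_algebra.
From mathcomp Require Import boolp classical_sets.

Set Implicit Arguments.
Unset Strict Implicit.
Unset Printing Implicit Defensive.

Import Order.TTheory GRing.Theory.

Local Open Scope ring_scope.
Local Open Scope mv_scope.

(** Both isomorphisms come from one comparison. Say that a map [h] from a
    PMVf-algebra [A] to an l_u-ring [R] is a model of [A] when it
    identifies [A] with the unit interval of [R], product included. The
    inclusion of Gamma(R) in [R] is a model of Gamma(R), almost by definition,
    and the canonical map from [A] to its sharp is a model of [A]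
    ([gamma_model_sharp]). The second fact gives the first isomorphism; the
    second isomorphism follows because any two models of the same algebra are
    isomorphic ([gamma_model_unique]).

    The main tool is the set [gamma_span h] of the elements
    h a_1 + ... + h a_n - m u, that is, the additive group generated by the
    image of [h]. The identity h a + h b = h (a ⊕ b) + h (a ⊙ b) lets one
    rewrite a sum of n values of [h] as its meet with u, which is again a value
    of [h], plus a sum of n - 1 values ([carry_sum], [carry_meet]). Subtracting
    u and taking the positive part therefore just removes one summand, so the
    positive part of an element of the span is a plain sum of values of [h]
    ([gamma_span_pos]). Consequently the span is closed under the lattice
    operations, hence a sub-l-ring when [h] is multiplicative, and its elements
    between 0 and u are values of [h] ([gamma_span_onto]).

    Applied to the map from [A] to the product of the chains attached to its
    prime quotients, this says that the sub-l-ring generated by [A] contains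
    nothing new between 0 and u. Injectivity of that map is the subdirect
    representation theorem: a nonzero element is avoided by some prime ideal
    ([prime_separation]).

    Applied to the pairing of two models [h] and [k] into the product R x S, it
    produces a sub-l-ring of R x S, and this sub-l-ring is the graph of the
    isomorphism. It projects onto each factor because a strong unit makes every
    element a difference as above ([gamma_model_span]). It projects injectively
    because the positive part of an element with vanishing first coordinate is
    a sum of pairs whose nonnegative first coordinates add up to 0; each of
    them vanishes, and then so does each pair ([diag_span_inj]). *)

(** * Prime ideals separate points *)

Section PrimeSeparation.
Variable A : mvType.
Implicit Types a b c v w x y : A.
Local Notation o := (@mvzero A).

Lemma mvmeetD_le a b c : a ∧ (b ⊕ c) ≤ (a ∧ b) ⊕ (a ∧ c).
Proof.
set t := a ∧ (b ⊕ c).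
have ta : t ≤ a by apply: mvmeet_lel.
have tbc : t ≤ b ⊕ c by apply: mvmeet_ler.
have tb : t ∧ b ≤ a ∧ b.
  by rewrite mvle_meet mvmeet_ler andbT; apply: mvle_trans ta; apply: mvmeet_lel.
have tc : t ⊖ (t ∧ b) ≤ a ∧ c.
  (* [t ∧ _] is [t ⊖ (t ⊖ _)], so both sides are three nested subtractions *)
  rewrite -[t ⊖ (t ∧ b)]/(t ∧ (t ⊖ b)) mvle_meet.
  rewrite (mvle_trans (mvmeet_lel _ _) ta) /=.
  by apply: mvle_trans (mvmeet_ler _ _) _; rewrite mvle_subl.
apply: mvle_trans (mvle_subK t (t ∧ b)) _.
exact: mvle_trans (mvle_add2r _ tb) (mvle_add2l _ tc).
Qed.

Definition mvmuln n v : A := iter n (mvadd v) o.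

Lemma mvmulnD m n v : mvmuln m v ⊕ mvmuln n v = mvmuln (m + n) v.
Proof. by elim: m => [|m IH]; rewrite ?mv0add // /mvmuln addSn /= -mvaddA IH. Qed.

Lemma mvmeet_muln n v w : v ∧ w = o -> mvmuln n v ∧ w = o.
Proof.
move=> vw; apply/eqP; rewrite -mvle0E mvmeetC; elim: n => [|n IH].
  exact: mvmeet_ler.
apply: mvle_trans (mvmeetD_le _ _ _) _.
by rewrite mvmeetC vw mv0add.
Qed.

Lemma mvmeet_muln2 m n v w : v ∧ w = o -> mvmuln m v ∧ mvmuln n w = o.
Proof.
by move=> vw; apply: mvmeet_muln; rewrite mvmeetC mvmeet_muln // mvmeetC.
Qed.

(** The empty set is allowed, so that the union of an empty chain qualifies and
    Zorn's lemma applies without a special case. *)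
Definition avoiding a (I : set A) : Prop :=
  [/\ forall x y, x ≤ y -> I y -> I x,
      forall x y, I x -> I y -> I (x ⊕ y) & ~ I a].

(** The ideal generated by [I] and [v]; the alternative [p = o] makes it
    contain [v] when [I] is empty. *)
Definition ideal_adjoin (I : set A) v : set A :=
  fun x => exists2 p, p = o \/ I p & exists n, x ≤ p ⊕ mvmuln n v.

(** Maximality only against adjoining a single element, which is all that the
    proof of primality compares [M] with. *)
Lemma exists_maximal_avoiding a : exists M : set A, avoiding a M /\
  forall v, M v \/ ideal_adjoin M v a.
Proof.
have [|M [[Mdown Madd Ma] Mmax]] := @Zorn_bigcup A (avoiding a).
  move=> F FP tot; split.
  - move=> x y xy [X FX Xy]; exists X => //.
    by have [d _ _] := FP _ FX; apply: d xy Xy.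
  - move=> x y [X FX Xx] [Y FY Yy].
    have [XY|YX] := tot X Y FX FY.
      by exists Y => //; have [_ d _] := FP _ FY; apply: d => //; apply: XY.
    by exists X => //; have [_ d _] := FP _ FX; apply: d => //; apply: YX.
  - by move=> [X FX Xa]; have [_ _ /(_ Xa)] := FP _ FX.
exists M; split=> [//|v]; have [|Mv] := pselect (M v); first by left.
right; apply: contrapT => Ea; apply: (Mmax (ideal_adjoin M v)).
  split.
    move=> x Mx; exists x; first by right.
    by exists 0%N; rewrite mvadd0 mvle_refl.
  move/(_ v); apply: contra_not Mv; apply; exists o; first by left.
  by exists 1%N; rewrite mv0add /mvmuln /= mvadd0 mvle_refl.
split=> // [x y xy [p Mp [n yn]]|x y [p Mp [n xn]] [q Mq [m ym]]].
  by exists p => //; exists n; apply: mvle_trans yn.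
exists (p ⊕ q).
  case: Mp Mq => [->|Mp] [->|Mq]; rewrite ?mv0add ?mvadd0;
    by [left|right|right; apply: Madd].
exists (n + m)%N; rewrite -mvmulnD -mvaddA (mvaddCA q) mvaddA.
exact: mvle_trans (mvle_add2r _ xn) (mvle_add2l _ ym).
Qed.

(** A maximal ideal among those avoiding [a] is prime. If neither [x ⊖ y] nor
    [y ⊖ x] lies in [M], adjoining either of them captures [a], so that modulo
    [M] the element [a] lies below multiples of both; such multiples are
    disjoint because [x ⊖ y] and [y ⊖ x] are, whence [a] is in [M]. *)
Lemma prime_separation a : a <> o -> exists P : Spec A, ~ P a.
Proof.
move=> a0; have [M [[Mdown Madd Ma] Mmax]] := exists_maximal_avoiding a.
(* adjoining [o] captures [a] only if [a = o] or [a] is already in [M] *)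
have M0 : M o.
  have [//|[p Mp [n an]]] := Mmax o.
  have {}an : a ≤ p.
    suff <- : p ⊕ mvmuln n o = p by [].
    by elim: n {an} => [|n IH]; rewrite /mvmuln /= ?mvadd0 // mv0add.
  case: Mp an => [->|Mp]; first by rewrite mvle0E => /eqP.
  by move=> /Mdown/(_ Mp).
have adj v : ~ M v -> exists2 p, M p & exists n, a ≤ p ⊕ mvmuln n v.
  by move=> Mv; have [//|[p [->|Mp] h]] := Mmax v; [exists o|exists p].
have Mlin x y : M (x ⊖ y) \/ M (y ⊖ x).
  apply: contrapT => /not_orP[/adj[p Mp [m am]] /adj[q Mq [n an]]].
  apply/Ma/(Mdown _ _ _ (Madd _ _ Mp Mq)).
  rewrite /mvle -mvle0E -(mvmeet_muln2 m n (mvprelinear x y)) mvle_meet.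
  rewrite !mvle_subl; apply/andP; split.
    by apply: mvle_trans am _; apply: mvle_add2r; apply: mvle_add.
  by apply: mvle_trans an _; apply: mvle_add2r; apply: mvle_addl.
have Mprime x y : M (x ∧ y) -> M x \/ M y.
  have half z t : M (z ⊖ t) -> M (z ∧ t) -> M z.
    by move=> ? ?; apply: Mdown (mvle_subK z (z ⊖ t)) _; apply: Madd.
  move=> Mxy; have [xy|yx] := Mlin x y; [left|right].
    exact: half xy Mxy.
  by apply: half yx _; rewrite mvmeetC.
by exists (@PrimeMVIdeal A (MVIdeal (ex_intro _ o M0) Mdown Madd) Mprime).
Qed.

End PrimeSeparation.

(** * The group spanned by a Gamma-homomorphism *)

Section GammaHom.
Variables (A : mvType) (R : lgroupType) (h : A -> R).
Implicit Types (a b c : A) (x y z : R) (l : seq A) (m n : nat).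
Local Notation u := (@mvtop A).
Local Notation U := (h u).

(** The conditions for [h] to be an MV-homomorphism into the interval from 0 to
    [U]. No unit is fixed in [R], so that products of l-rings, which need not
    have a strong unit, are covered. *)
Record gamma_hom : Prop := {
  gamma_homD : forall a b, h (a ⊕ b) = (h a + h b) ⊓ U;
  gamma_homN : forall a, h (¬ a) = U - h a
}.

Hypothesis hP : gamma_hom.

Lemma gamma_hom0 : h mvzero = 0.
Proof. by rewrite -mvnegT (gamma_homN hP) subrr. Qed.

(** The sum exceeds its truncation [h (a ⊕ b)] by the positive part of
    [h a + h b - U], and that is the value at [a ⊙ b]. *)
Lemma gamma_hom_carry a b : h (a ⊕ b) + h (a ⊙ b) = h a + h b.
Proof.
rewrite /mvmul (gamma_homN hP (_ ⊕ _)) !(gamma_homD hP).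
rewrite (gamma_homN hP a) (gamma_homN hP b).
rewrite [_ ⊓ U in X in _ + X]lg_meetC lg_pos_sub.
have -> : U - (U - h a + (U - h b)) = h a + h b - U.
  by rewrite opprD !opprB addrA [U + _]addrC subrK addrA.
by rewrite -lg_pos_sub addrC subrK.
Qed.

Lemma gamma_hom_ge0 a : 0 <= h a.
Proof.
have := gamma_homD hP a u; rewrite mvaddT => e.
by have := lg_meetl (h a + U) U; rewrite -e -[X in X <= _]add0r lg_leD2r.
Qed.

Lemma gamma_hom_leU a : h a <= U.
Proof. by have := gamma_hom_ge0 (¬ a); rewrite (gamma_homN hP) lg_subr_ge0. Qed.

(** One pass of additions with carry over [a :: l]: the first component is the
    truncated sum of the whole list, the second one collects the overflows. The
    point is that the overflow list is one entry shorter than [a :: l]. *)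
Fixpoint carry a l : A * seq A :=
  if l is b :: l' then
    let p := carry b l' in (a ⊕ p.1, a ⊙ p.1 :: p.2)
  else (a, [::]).

Lemma carry_sum a l :
  h (carry a l).1 + \sum_(c <- (carry a l).2) h c = h a + \sum_(c <- l) h c.
Proof.
elim: l a => [|b l IH] a; first by rewrite /= !big_nil.
by rewrite /= !big_cons -IH addrA gamma_hom_carry addrA.
Qed.

Lemma carry_meet a l :
  (h a + \sum_(c <- l) h c) ⊓ U = h (carry a l).1.
Proof.
elim: l a => [|b l IH] a /=.
  by rewrite big_nil addr0 lg_meet_l // gamma_hom_leU.
rewrite big_cons (gamma_homD hP) -IH lg_meetD -lg_meetA.
congr (_ ⊓ _); rewrite lg_meet_r //.
by rewrite -[leLHS]add0r lg_leD2r gamma_hom_ge0.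
Qed.

Lemma gamma_sum_ge0 l : 0 <= \sum_(c <- l) h c.
Proof.
elim: l => [|a l IH]; rewrite ?big_nil // big_cons.
by rewrite lg_addr_ge0 // gamma_hom_ge0.
Qed.

Lemma gamma_sum_meet l : exists a, (\sum_(c <- l) h c) ⊓ U = h a.
Proof.
case: l => [|a l]; last by exists (carry a l).1; rewrite big_cons carry_meet.
by exists mvzero; rewrite big_nil gamma_hom0 lg_meet_l // gamma_hom_ge0.
Qed.

(** By induction on [m]: subtracting [U] and taking the positive part turns the
    sum over [a :: l] into the sum over the overflow list of [carry a l]. *)
Lemma gamma_sum_pos l m : exists l',
  (\sum_(c <- l) h c - U *+ m) ⊔ 0 = \sum_(c <- l') h c.
Proof.
elim: m l => [|m IH] l.
  by exists l; rewrite mulr0n subr0 lg_join_l // gamma_sum_ge0.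
case: l => [|a l].
  exists [::]; rewrite big_nil sub0r lg_join_r // -[leRHS]oppr0 lg_leN2.
  exact/lg_mulrn_ge0/gamma_hom_ge0.
have [l' e] := IH (carry a l).2; exists l'; rewrite -e big_cons.
have -> : \sum_(c <- (carry a l).2) h c =
    (h a + \sum_(c <- l) h c - U) ⊔ 0.
  by rewrite -lg_pos_sub carry_meet -carry_sum addrC addKr.
rewrite lg_joinDr add0r -[_ - U - _]addrA -opprD -mulrS.
set y := _ - _ *+ m.+1; apply/le_anti; rewrite !ljoinP !lg_joinr !andbT.
set z := - _; have z0 : z <= 0.
  rewrite -[leRHS]oppr0 lg_leN2; exact/lg_mulrn_ge0/gamma_hom_ge0.
rewrite (le_trans z0 (lg_joinr _ _)) lg_joinl /= andbT.
exact: le_trans (lg_joinl _ _) (lg_joinl _ _).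
Qed.

Definition gamma_span : set R :=
  fun x => exists l m, x = \sum_(c <- l) h c - U *+ m.

Lemma gamma_span_hom a : gamma_span (h a).
Proof. by exists [:: a], 0%N; rewrite big_seq1 mulr0n subr0. Qed.

Lemma gamma_span_sum l : gamma_span (\sum_(c <- l) h c).
Proof. by exists l, 0%N; rewrite mulr0n subr0. Qed.

Lemma gamma_spanD x y : gamma_span x -> gamma_span y -> gamma_span (x + y).
Proof.
move=> [l [m ->]] [k [n ->]]; exists (l ++ k), (m + n)%N.
by rewrite big_cat mulrnDr opprD addrACA.
Qed.

(** Since [- h a = h (¬ a) - U], opposites of sums of values have the required
    form. *)
Lemma gamma_spanN x : gamma_span x -> gamma_span (- x).
Proof.
move=> [l [m ->]].
have negsum k : gamma_span (- \sum_(c <- k) h c).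
  exists [seq ¬ c | c <- k], (size k).
  elim: k => [|a k IH]; first by rewrite !big_nil mulr0n subr0 oppr0.
  rewrite /= !big_cons opprD IH mulrS opprD addrACA (gamma_homN hP).
  by rewrite [U - _]addrC addrK.
rewrite opprB; apply: gamma_spanD (negsum l).
suff -> : U *+ m = \sum_(c <- nseq m u) h c by apply: gamma_span_sum.
by elim: m => [|m IH]; rewrite ?big_nil ?mulr0n //= big_cons mulrS IH.
Qed.

Lemma gamma_spanB x y : gamma_span x -> gamma_span y -> gamma_span (x - y).
Proof. by move=> Sx Sy; apply: gamma_spanD Sx (gamma_spanN Sy). Qed.

Lemma gamma_span_ind (P : R -> Prop) : (forall a, P (h a)) ->
  (forall x y, P x -> P y -> P (x - y)) -> forall x, gamma_span x -> P x.
Proof.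
move=> Ph PB; have P0 : P 0 by rewrite -gamma_hom0.
have PD x y : P x -> P y -> P (x + y).
  move=> Px Py; rewrite -[y]opprK; apply: (PB) => //.
  by rewrite -sub0r; apply: PB.
move=> _ [l [m ->]]; apply: PB.
  by elim: l => [|a l IH]; rewrite ?big_nil // big_cons; apply: PD.
by elim: m => [|m IH]; rewrite ?mulr0n // mulrS; apply: PD.
Qed.

Lemma gamma_span_pos x : gamma_span x ->
  exists l, x ⊔ 0 = \sum_(c <- l) h c.
Proof. by move=> [l [m ->]]; apply: gamma_sum_pos. Qed.

Lemma gamma_span_onto x : gamma_span x -> 0 <= x -> x <= U ->
  exists a, x = h a.
Proof.
move=> /gamma_span_pos[l xl] x0 xU; have [a e] := gamma_sum_meet l.
by exists a; rewrite -e -xl lg_join_l // lg_meet_l.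
Qed.

End GammaHom.

(** Meets reduce to positive parts by [x ⊓ y = x - ((x - y) ⊔ 0)], joins to
    meets by taking opposites, and products to products of generators by
    distributivity. *)
Lemma is_sublring_gamma_span (A : pmvfType) (R : lringType) (h : A -> R) :
  gamma_hom h -> (forall a b, h (a ⋅ b) = h a ∙ h b) ->
  is_sublring (gamma_span h).
Proof.
move=> hP hM.
have pos x : gamma_span h x -> gamma_span h (x ⊔ 0).
  by move=> /(gamma_span_pos hP)[l ->]; apply: gamma_span_sum.
have meet x y : gamma_span h x -> gamma_span h y -> gamma_span h (x ⊓ y).
  move=> Sx Sy; have -> : x ⊓ y = x - ((x - y) ⊔ 0).
    by rewrite -lg_pos_sub opprB addrC subrK.
  exact/(gamma_spanB hP)/pos/(gamma_spanB hP).
split=> // [|x y|x y Sx|x y Sx Sy].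
- by rewrite -(gamma_hom0 hP); apply: gamma_span_hom.
- exact: gamma_spanB.
- elim/(gamma_span_ind hP): Sx y => [a|x1 x2 IH1 IH2] y Sy.
    elim/(gamma_span_ind hP): Sy => [b|y1 y2 IH1 IH2].
      by rewrite -hM; apply: gamma_span_hom.
    by rewrite lmulBr; apply: (gamma_spanB hP).
  rewrite lmulDl lmulNl; apply: (gamma_spanB hP); [exact: IH1|exact: IH2].
- rewrite -[x ⊔ y]opprK lg_oppU; apply/(gamma_spanN hP)/meet;
    exact: gamma_spanN.
Qed.

(** * Models of an algebra as a unit interval *)

Record gamma_model (A : pmvfType) (R : luRingType) (h : A -> R) : Prop := {
  gamma_model_hom : gamma_hom h;
  gamma_modelT : h mvtop = lunit;
  gamma_modelM : forall a b, h (a ⋅ b) = h a ∙ h b;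
  gamma_model_inj : injective h;
  gamma_model_onto : forall x, 0 <= x <= lunit -> exists a, x = h a
}.

(** An element between 0 and [n] times the unit is a sum of elements of the unit
    interval: split off its meet with the unit, which leaves an element below
    [n - 1] times the unit. A general element is a translate of such an
    element by a multiple of the unit. *)
Lemma gamma_model_span (A : pmvfType) (R : luRingType) (h : A -> R) :
  gamma_model h -> forall x, gamma_span h x.
Proof.
move=> [hP hT _ _ onto] x.
have pos n y : 0 <= y -> y <= lunit *+ n -> gamma_span h y.
  elim: n y => [|n IH] y y0 yn.
    have -> : y = 0 by apply/le_anti; rewrite y0 -(mulr0n lunit) yn.
    by rewrite -(gamma_hom0 hP); apply: gamma_span_hom.
  have [|a ya] := onto (y ⊓ lunit).
    by rewrite lmeetP y0 lunit_ge0 lg_meetr.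
  rewrite -(subrK (y ⊓ lunit) y); apply: (gamma_spanD _); last first.
    by rewrite ya; apply: gamma_span_hom.
  rewrite lg_pos_sub; apply: IH; first exact: lg_joinr.
  rewrite ljoinP lg_leBl -mulrSr yn /=.
  exact/lg_mulrn_ge0/lunit_ge0.
have [n xn] := lunit_strong x; move: xn; rewrite ljoinP => /andP[xn nx].
rewrite -(addrK (lunit *+ n) x); apply: (gamma_spanB hP).
  apply: (pos (n + n)%N); last by rewrite mulrnDr lg_leD2r.
  by rewrite -[_ *+ n]opprK lg_subr_ge0 -lg_leN2 opprK.
by exists (nseq n mvtop), 0%N; rewrite mulr0n subr0 -hT; elim: (n) => [|k IH];
  rewrite /= ?big_nil ?mulr0n // big_cons mulrS IH.
Qed.

(** * Comparison of two models *)

Section Product.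
Variables (I : Type) (F : I -> lringType).
Implicit Types x y : lprod F.

Lemma lprod_eq x y : (forall i, x i = y i) -> x = y.
Proof. exact: functional_extensionality_dep. Qed.

Lemma gamma_hom_prod (A : mvType) (h : forall i, A -> F i) :
  (forall i, gamma_hom (h i)) -> gamma_hom (fun a => (h^~ a : lprod F)).
Proof.
move=> hP; split=> [a b|a]; apply: lprod_eq => i.
  exact: gamma_homD (hP i) a b.
exact: gamma_homN (hP i) a.
Qed.

Lemma lprod_sum (J : Type) (l : seq J) (f : J -> lprod F) i :
  (\sum_(j <- l) f j) i = \sum_(j <- l) f j i.
Proof. by elim: l => [|j l IH]; rewrite ?big_nil // !big_cons -IH. Qed.

Lemma lprod_muln x n i : (x *+ n) i = x i *+ n.
Proof. by elim: n => [|n IH]; rewrite ?mulr0n // !mulrS -IH. Qed.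

End Product.

(** Families of models are compared through their diagonal map into the product.
    A family, rather than a pair, treats both coordinates alike and reuses the
    product of l-rings that defines the sharp. *)
Section Comparison.
Variables (A : pmvfType) (I : Type) (F : I -> luRingType).
Variable h : forall i, A -> F i.
Hypothesis hP : forall i, gamma_model (h i).

Let diag (a : A) : lprod F := h^~ a.
Let diagP : gamma_hom diag.
Proof. by apply: gamma_hom_prod => i; apply: gamma_model_hom. Qed.

Lemma is_sublring_diag : is_sublring (gamma_span diag).
Proof.
apply: is_sublring_gamma_span => // a b; apply: lprod_eq => i.
exact: gamma_modelM.
Qed.

Lemma diag_span_surj i (x : F i) : exists2 z, gamma_span diag z & z i = x.
Proof.
have [l [m ->]] := gamma_model_span (hP i) x.
exists (\sum_(c <- l) diag c - diag mvtop *+ m); first by exists l, m.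
rewrite -[LHS]/((\sum_(c <- l) diag c) i - (diag mvtop *+ m) i).
by rewrite lprod_sum lprod_muln.
Qed.

(** The values [h i a] are nonnegative, so a sum of them vanishes only if each of
    them does, and then every [a] involved is zero because [h i] is injective.
    Positive parts of elements of the span are such sums, and an element is the
    difference of the positive parts of itself and of its opposite. *)
Lemma diag_span_inj i (y z : lprod F) :
  gamma_span diag y -> gamma_span diag z -> y i = z i -> y = z.
Proof.
have sum0 l : (\sum_(c <- l) diag c) i = 0 -> \sum_(c <- l) diag c = 0.
  elim: l => [|a l IH]; rewrite ?big_nil // big_cons => e.
  have hi := gamma_model_hom (hP i).
  have e' : h i a + \sum_(c <- l) h i c = 0.
    by rewrite -[RHS]e -[RHS]/(_ + (\sum_(c <- l) diag c) i) lprod_sum.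
  have a0 : h i a = 0.
    apply/le_anti; rewrite (gamma_hom_ge0 hi) andbT -e' -[leLHS]addr0 lg_leD2l.
    exact: gamma_sum_ge0.
  have -> : a = mvzero.
    by apply: (gamma_model_inj (hP i)); rewrite a0 (gamma_hom0 hi).
  rewrite (gamma_hom0 diagP) add0r; apply: IH.
  by rewrite lprod_sum -[RHS]e' a0 add0r.
have pos0 (x : lprod F) : gamma_span diag x -> x i = 0 -> x ⊔ 0 = 0.
  move=> /(gamma_span_pos diagP)[l xl] xi; rewrite xl; apply: sum0.
  by rewrite -xl -[LHS]/(x i ⊔ 0) xi lg_join_l.
move=> Sy Sz e; apply/eqP; rewrite -subr_eq0; apply/eqP.
have yz : (y - z) i = 0 by rewrite -[LHS]/(y i - z i) e subrr.
rewrite (lg_split (y - z)) !pos0 ?subr0 //.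
- exact/(gamma_spanN diagP)/(gamma_spanB diagP).
- by rewrite -[LHS]/(- (y - z) i) yz oppr0.
exact: (gamma_spanB diagP).
Qed.

(** The span of the diagonal map is the graph of the isomorphism: [p x] is its
    only point with coordinate [x] at [i]. *)
Lemma gamma_model_compare i j : exists g : F i -> F j, is_luring_iso g.
Proof.
have ex k (x : F k) : exists z, gamma_span diag z /\ z k = x.
  by have [z Sz zx] := diag_span_surj x; exists z.
have [p pP] := choice (ex i); have [q qP] := choice (ex j).
have [S0 SB SM SI SU] := is_sublring_diag.
have SD y z : gamma_span diag y -> gamma_span diag z -> gamma_span diag (y + z).
  exact: gamma_spanD.
have pE x z : gamma_span diag z -> z i = x -> p x = z.
  move=> Sz zx; have [Sp e] := pP x.
  by apply: (diag_span_inj (i := i)) => //; rewrite e.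
exists (fun x => p x j); split; last first.
  exists (fun y => q y i) => [x|y].
    have [Sp px] := pP x; have [Sq e] := qP (p x j).
    by rewrite (diag_span_inj Sq Sp e).
  have [Sq qy] := qP y.
  by rewrite (pE _ (q y)).
split=> [x y|x y|x y|x y|].
- have [[Sx ex1] [Sy ey]] := (pP x, pP y).
  rewrite (pE _ (p x + p y)) //; first exact: SD.
  by rewrite -[LHS]/(p x i + p y i) ex1 ey.
- have [[Sx ex1] [Sy ey]] := (pP x, pP y).
  rewrite (pE _ (p x ∙ p y)) //; first exact: SM.
  by rewrite -[LHS]/(p x i ∙ p y i) ex1 ey.
- have [[Sx ex1] [Sy ey]] := (pP x, pP y).
  rewrite (pE _ (p x ⊓ p y)) //; first exact: SI.
  by rewrite -[LHS]/(p x i ⊓ p y i) ex1 ey.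
- have [[Sx ex1] [Sy ey]] := (pP x, pP y).
  rewrite (pE _ (p x ⊔ p y)) //; first exact: SU.
  by rewrite -[LHS]/(p x i ⊔ p y i) ex1 ey.
rewrite (pE _ (diag mvtop)); [exact: gamma_modelT|exact: gamma_span_hom|].
exact: gamma_modelT.
Qed.

End Comparison.

Theorem gamma_model_unique (A : pmvfType) (R S : luRingType)
    (h : A -> R) (k : A -> S) : gamma_model h -> gamma_model k ->
  exists g : R -> S, is_luring_iso g.
Proof.
move=> hP kP; pose F (b : bool) := if b then R else S.
pose f b : A -> F b :=
  if b as b0 return A -> F b0 then h else k.
have fP b : gamma_model (f b) by case: b.
exact: gamma_model_compare fP true false.
Qed.

(** * The two models of interest *)

Lemma gamma_model_iso (A : pmvfType) (S : semiLowLuRingType) (h : A -> S) :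
  gamma_model h -> exists f : A -> Gamma S, is_pmvf_iso f.
Proof.
move=> [hP hT hM hI onto].
have h01 a : (0 <= h a) && (h a <= lunit).
  by rewrite -hT (gamma_hom_ge0 hP) (gamma_hom_leU hP).
pose f a := GammaElt (h01 a).
have fonto (y : Gamma S) : exists a, f a = y.
  have [a ya] := onto _ (valP y); exists a; apply: val_inj; exact/esym.
have fI : injective f by move=> a b /(congr1 val); apply: hI.
exists f; split.
  split=> [a b|a||a b]; apply: val_inj.
  - by rewrite /= (gamma_homD hP) hT.
  - by rewrite /= (gamma_homN hP) hT.
  - exact: gamma_hom0.
  - exact: hM.
have [g gP] := choice fonto; exists g => // a; exact/fI/gP.
Qed.

Lemma gamma_model_Gamma (R : semiLowLuRingType) :
  gamma_model (val : Gamma R -> R).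
Proof.
have T : val (mvtop : Gamma R) = lunit by exact: subr0.
split=> //; [|exact: val_inj|by move=> x x01; exists (GammaElt x01)].
by split=> [a b|a]; rewrite T.
Qed.

Section ChainInjection.
Variable C : pmvfChainType.

Lemma gamma_hom_cinj : gamma_hom (@cinj C).
Proof.
split=> [a b|a]; last first.
  rewrite -[in RHS](mvaddN a) cinjD ?mvmulN //.
  by rewrite addrC addKr.
case: (mvchain_carry a b) => e.
  by rewrite -cinjD // lg_meet_l //; apply/cinj_le/mvleT.
rewrite -cinjDT // e lg_meet_r // -[leLHS]addr0 lg_leD2l; exact: cinj_ge0.
Qed.

(** In a nontrivial chain an element of the sharp has one normal form [cnf], and
    the unit, whose normal form is [(1, mvzero)], is the only element of [C]
    not in normal form as [(0, a)]. *)
Lemma cinj_inj : injective (@cinj C).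
Proof.
move=> a b e; have [t|/eqP nt] := eqVneq (@mvtop C) mvzero.
  by apply: mvle_anti; apply: mvle_trans (mvleT _) _; rewrite t mvle0.
have := csharp_lift (f := @cnf C) _ e; rewrite /cnf /=.
have [->|_] := eqVneq a mvtop; have [->|_] := eqVneq b mvtop => // h.
- by have := h _; rewrite eqxx; case: eqP => [/esym //|_] /(_ (fun=> erefl)).
- by have := h _; rewrite eqxx; case: eqP => [/esym //|_] /(_ (fun=> erefl)).
by have := h _; rewrite eqxx; case: eqP => [/esym //|_] /(_ (fun=> erefl)) [].
Qed.

End ChainInjection.

Section SharpModel.
Variable A : pmvfType.

Lemma gamma_hom_hat : gamma_hom (@hat A).
Proof.
apply: gamma_hom_prod => P; have cP := gamma_hom_cinj (mvquot P).
have T : mvclass P mvtop = mvtop by exact: mvclassN.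
by split=> [a b|a]; rewrite T ?mvclassD ?mvclassN;
  [apply: gamma_homD|apply: gamma_homN].
Qed.

Lemma hatM (a b : A) : hat (a ⋅ b) = hat a ∙ hat b.
Proof.
apply: lprod_eq => P.
exact: etrans (congr1 (@cinj _) (mvclassM P a b)) (esym (cinjM _ _)).
Qed.

(** If [x ⊖ y] is nonzero, some prime ideal avoids it, and the components of
    [hat x] and [hat y] at that ideal differ. *)
Lemma hat_inj : injective (@hat A).
Proof.
move=> a b e.
have le x y : hat x = hat y -> x ≤ y.
  move=> exy; apply/eqP; apply: contrapT => ne.
  have [P] := prime_separation ne; apply.
  have /cinj_inj/mvclass_eq[] // : hat x P = hat y P by rewrite exy.
by apply: mvle_anti; apply: le.
Qed.

(** The sharp is generated by the image of [hat] as a sub-l-ring, while the group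
    spanned by that image is already a sub-l-ring; hence the elements of its
    unit interval come from [A]. *)
Lemma gamma_model_sharp : gamma_model (@sharp_hat A).
Proof.
have hP := gamma_hom_hat.
split=> //.
- by split=> [a b|a]; apply: val_inj; [apply: gamma_homD|apply: gamma_homN].
- by move=> a b; apply: val_inj; apply: hatM.
- by move=> a b /(congr1 val); apply: hat_inj.
move=> x /andP[x0 x1].
have Sx : gamma_span (@hat A) (val x).
  apply: smallest_sub (lgenP x); first exact: is_sublring_gamma_span hP hatM.
  by move=> _ [a _ <-]; apply: gamma_span_hom.
have [a xa] := gamma_span_onto hP Sx x0 x1.
by exists a; apply: val_inj.
Qed.

End SharpModel.

Theorem theorem5p27 :
  (forall A : pmvfType,
     exists f : A -> Gamma (sharp A), is_pmvf_iso f) /\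
  (forall R : semiLowLuRingType,
     exists g : R -> sharp (Gamma R), is_luring_iso g).
Proof.
split=> [A|R]; first exact: gamma_model_iso (gamma_model_sharp A).
exact: gamma_model_unique (gamma_model_Gamma R) (gamma_model_sharp _).
Qed.
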